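(* Let $c\in\mathbb R$ with $c\neq0$, and let $r,s\in C^1[0,\infty)$ and $u\in C[0,\infty)$ be real-valued functions satisfying $$\dot s(t)=2r(t)u(t),\qquad \dot r(t)=-2c\,u(t),$$ with $\operatorname{sgn}(u(t))=\operatorname{sgn}(r(t))$ for all $t>0$, $s(0)>0$, $r(0)>0$, and with $r(t)>0$, $s(t)>0$ for all $t>0$. Let $h>0$, $k\ge0$. For $t>0$ define $$W_t(x)=\Big(\frac{h\,r^2(t)}{c}\Big)^xe^{-\frac{h r^2(t)}{c^2}},\qquad x\in\mathbb N,$$ and let $U_t:\ell^2(\mathbb N)\to L^2(\mathbb N,W_t)$ be defined by $$U_te_n(x)=\big(-\operatorname{sgn}(r/c)\big)^n\,C_n\Big(x;\frac{h r^2(t)}{c^2}\Big),\qquad x\in\mathbb N.$$ Then $U_t$ is unitary and $U_t\circ\pi_{k,h}(L(t))\circ U_t^*=M(2c(x+k)+Ch)$, where $C=\frac1{2c}r^2+s$.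
   Context: $\mathbb N=\{0,1,2,\dots\}$. The Lie algebra considered (the oscillator algebra $\mathfrak b(1)$) has basis $E,F,H,N$ with $[E,F]=N$, $[H,E]=2E$, $[H,F]=-2F$, $N$ central, and $*$-structure $H^*=H$, $N^*=N$, $E^*=F$. The Lax operator is $L(t)=cH+r(t)(E+F)+s(t)N$; its Lax partner is $u(t)(E-F)$, and the differential equations in the claim are the Lax equation $\dot L=[u(E-F),L]$. The quantity $r^2+2cs$ is independent of $t$. The representation $\pi_{k,h}$ ($h>0$, $k\ge0$) on $\ell^2(\mathbb N)$ with standard orthonormal basis $\{e_n\}$ is given by $\pi_{k,h}(N)e_n=-h\,e_n$, $\pi_{k,h}(H)e_n=2(k+n)e_n$, $\pi_{k,h}(E)e_n=\sqrt{h(n+1)}\,e_{n+1}$, $\pi_{k,h}(F)e_n=\sqrt{hn}\,e_{n-1}$. Hence $$\pi_{k,h}(L(t))e_n=r(t)\sqrt{h(n+1)}\,e_{n+1}+[2c(n+k)-hs(t)]e_n+r(t)\sqrt{hn}\,e_{n-1}.$$ The orthonormal Charlier polynomials are, for $a>0$ and $n,x\in\mathbb N$, $$C_n(x;a)=\sqrt{\frac{a^n}{n!}}\;{}_2F_0\Big({-n,-x\atop-};-\frac1a\Big).$$ $L^2(\mathbb N,W)$ is the weighted space with inner product $\sum_{x\in\mathbb N}f(x)\overline{g(x)}W(x)$. $M(f)$ denotes the multiplication operator: $[M(f)g](x)=f(x)g(x)$.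
   Formalization: The printed formulas are false; corrected here with a = hr²/(4c²) replacing hr²/c²: the weight is W_t(x) = (a^x/x!)e^{-a}, the Charlier polynomials in U_t e_n have parameter a, and the multiplier is 2c(x+k) − Ch instead of 2c(x+k) + Ch. *)

(* Defs.v *)
From Stdlib Require Import Reals Factorial Lra Lia.
From Coquelicot Require Import Coquelicot.

Open Scope R_scope.

(** * Functions on [0, oo)

    They are represented by functions [R -> R], of which only the values on
    [0, oo) matter; at 0 the notions below are unit_weight-sided. *)

Definition continuous_on_halfline (f : R -> R) : Prop :=
  forall t, 0 <= t ->
    filterlim f (within (fun y => 0 <= y) (locally t)) (locally (f t)).

Definition is_derive_halfline (f : R -> R) (t l : R) : Prop :=
  filterlim (fun y => (f y - f t) / (y - t))
    (within (fun y => 0 <= y /\ y <> t) (locally t)) (locally l).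

Definition C1_halfline (f : R -> R) : Prop :=
  exists f' : R -> R,
    (forall t, 0 <= t -> is_derive_halfline f t (f' t)) /\
    continuous_on_halfline f'.

(** * The complex spaces L^2(N, W) and l^2(N) = L^2(N, 1)

    For a positive weight [W] no two distinct functions are identified in
    L^2(N, W), so elements are plain functions satisfying [in_L2 W]. *)

Definition Cseries (a : nat -> C) : C :=
  (Series (fun n => Re (a n)), Series (fun n => Im (a n))).

Definition in_L2 (W : nat -> R) (f : nat -> C) : Prop :=
  ex_series (fun x => Cmod (f x) ^ 2 * W x).

Definition ip (W : nat -> R) (f g : nat -> C) : C :=
  Cseries (fun x => (f x * Cconj (g x) * RtoC (W x))%C).

Definition L2norm (W : nat -> R) (f : nat -> C) : R :=
  sqrt (Series (fun x => Cmod (f x) ^ 2 * W x)).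

Definition unit_weight : nat -> R := fun _ => 1.

Definition basis_vec (n : nat) : nat -> C :=
  fun m => if Nat.eqb m n then RtoC 1 else RtoC 0.

Definition fadd (f g : nat -> C) : nat -> C := fun x => (f x + g x)%C.
Definition fsub (f g : nat -> C) : nat -> C := fun x => (f x - g x)%C.
Definition fscal (a : C) (f : nat -> C) : nat -> C := fun x => (a * f x)%C.

(** * Bounded operators *)

Definition maps_L2 (W1 W2 : nat -> R) (U : (nat -> C) -> nat -> C) : Prop :=
  forall v, in_L2 W1 v -> in_L2 W2 (U v).

Definition is_unitary (W1 W2 : nat -> R) (U : (nat -> C) -> nat -> C) : Prop :=
  maps_L2 W1 W2 U /\
  (forall (a : C) v w, in_L2 W1 v -> in_L2 W1 w ->
     forall x, U (fadd (fscal a v) w) x = fadd (fscal a (U v)) (U w) x) /\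
  (forall v w, in_L2 W1 v -> in_L2 W1 w -> ip W2 (U v) (U w) = ip W1 v w) /\
  (forall g, in_L2 W2 g -> exists v, in_L2 W1 v /\ forall x, U v x = g x).

Definition is_adjoint (W1 W2 : nat -> R) (U V : (nat -> C) -> nat -> C) : Prop :=
  maps_L2 W2 W1 V /\
  (forall v g, in_L2 W1 v -> in_L2 W2 g -> ip W2 (U v) g = ip W1 v (V g)).

(** * Unbounded operators, given by their graphs *)

Definition operator : Type := (nat -> C) -> (nat -> C) -> Prop.

Definition finitely_supported (v : nat -> C) : Prop :=
  exists n0 : nat, forall n, (n0 <= n)%nat -> v n = RtoC 0.

Definition on_finite (T : (nat -> C) -> nat -> C) : operator :=
  fun v w => finitely_supported v /\ forall n, w n = T v n.

Definition op_closure (W : nat -> R) (A : operator) : operator :=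
  fun v w => in_L2 W v /\ in_L2 W w /\
    forall eps : R, 0 < eps ->
      exists v' w', A v' w' /\
        L2norm W (fsub v' v) < eps /\ L2norm W (fsub w' w) < eps.

(** [U o A o V], where [V] is everywhere defined on L^2(N, W). *)
Definition op_conj (W : nat -> R) (U : (nat -> C) -> nat -> C) (A : operator)
    (V : (nat -> C) -> nat -> C) : operator :=
  fun g g' => in_L2 W g /\ exists w, A (V g) w /\ forall x, g' x = U w x.

(** Multiplication by [f] on its maximal domain. *)
Definition mult_op (W : nat -> R) (f : nat -> R) : operator :=
  fun g g' => in_L2 W g /\ in_L2 W g' /\ forall x, g' x = (RtoC (f x) * g x)%C.

Definition op_eq (A B : operator) : Prop := forall g g', A g g' <-> B g g'.

(** * The representation pi_{k,h} of the oscillator algebra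

    A vector is the sequence of its coefficients with respect to [basis_vec n], so the
    raising operator moves the coefficient of [basis_vec m] to position [S m]. *)

Definition pi_N (h : R) (v : nat -> C) : nat -> C :=
  fun n => (RtoC (- h) * v n)%C.

Definition pi_H (k : R) (v : nat -> C) : nat -> C :=
  fun n => (RtoC (2 * (k + INR n)) * v n)%C.

Definition pi_E (h : R) (v : nat -> C) : nat -> C :=
  fun n => match n with
           | O => RtoC 0
           | S m => (RtoC (sqrt (h * INR (S m))) * v m)%C
           end.

Definition pi_F (h : R) (v : nat -> C) : nat -> C :=
  fun n => (RtoC (sqrt (h * INR (S n))) * v (S n))%C.

(** The image of c H + r (E + F) + s N. *)
Definition pi_lax (k h c r s : R) (v : nat -> C) : nat -> C :=
  fadd (fadd (fscal (RtoC c) (pi_H k v))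
             (fscal (RtoC r) (fadd (pi_E h v) (pi_F h v))))
       (fscal (RtoC s) (pi_N h v)).

(** The closure of the operator defined on finite linear combinations of the
    basis vectors. *)
Definition lax_op (k h c r s : R) : operator :=
  op_closure unit_weight (on_finite (pi_lax k h c r s)).

Lemma pi_lax_basis_vec (k h c r s : R) (n m : nat) :
  pi_lax k h c r s (basis_vec n) m =
  (RtoC (r * sqrt (h * INR (S n))) * basis_vec (S n) m
   + RtoC (2 * c * (INR n + k) - h * s) * basis_vec n m
   + RtoC (r * sqrt (h * INR n)) *
       match n with O => RtoC 0 | S n' => basis_vec n' m end)%C.
Proof.
assert (HE : pi_E h (basis_vec n) m = (RtoC (sqrt (h * INR (S n))) * basis_vec (S n) m)%C).
{ unfold pi_E, basis_vec. destruct m as [|m]; cbn [Nat.eqb].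
  - ring.
  - destruct (Nat.eqb_spec m n) as [->|]; ring. }
assert (HF : pi_F h (basis_vec n) m = (RtoC (sqrt (h * INR n)) *
       match n with O => RtoC 0 | S n' => basis_vec n' m end)%C).
{ unfold pi_F, basis_vec. destruct n as [|n]; cbn [Nat.eqb].
  - ring.
  - destruct (Nat.eqb_spec m n) as [->|]; ring. }
assert (HD : (RtoC (2 * (k + INR m)) * basis_vec n m
              = RtoC (2 * (k + INR n)) * basis_vec n m)%C).
{ unfold basis_vec. destruct (Nat.eqb_spec m n) as [->|]; ring. }
unfold pi_lax, fadd, fscal, pi_H, pi_N. rewrite HE, HF, HD.
rewrite !RtoC_mult, RtoC_minus, !RtoC_mult, RtoC_opp, !RtoC_plus. ring.
Qed.

(** * Charlier polynomials *)

Fixpoint poch (a : R) (j : nat) : R :=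
  match j with
  | O => 1
  | S i => poch a i * (a + INR i)
  end.

(** 2F0(-n, b; -; z): the series terminates because (-n)_j = 0 for j > n. *)
Definition hyp2F0_neg (n : nat) (b z : R) : R :=
  sum_n (fun j => poch (- INR n) j * poch b j / INR (fact j) * z ^ j) n.

Definition charlier (n x : nat) (a : R) : R :=
  sqrt (a ^ n / INR (fact n)) * hyp2F0_neg n (- INR x) (- (1 / a)).

(** The Poisson weight: the Charlier polynomials above are orthonormal in
    L^2(N, [charlier_weight a]). *)
Definition charlier_weight (a : R) (x : nat) : R :=
  a ^ x / INR (fact x) * exp (- a).

(** With a = h r^2 / (4 c^2), the three-term recurrence
      x C_n = - sqrt (a (n+1)) C_(n+1) + (n + a) C_n - sqrt (a n) C_(n-1),
    multiplied by 2c, has the off-diagonal coefficients +- r sqrt (h (n+1))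
    of the Lax operator; this is what fixes the factor 4. *)
Definition charlier_param (h c r : R) : R := h * r ^ 2 / (4 * c ^ 2).

Definition weight (h c r : R) : nat -> R := charlier_weight (charlier_param h c r).

Definition U_basis (h c r : R) (n : nat) : nat -> C :=
  fun x => RtoC ((- sign (r / c)) ^ n * charlier n x (charlier_param h c r)).

(** The continuous linear extension of e_n |-> [U_basis h c r n]: point
    evaluations are continuous on L^2(N, W), so the image of sum_n v_n e_n may
    be computed pointwise. *)
Definition U_op (h c r : R) (v : nat -> C) : nat -> C :=
  fun x => Cseries (fun n => (v n * U_basis h c r n x)%C).

Lemma Series_single (a : nat -> R) (n : nat) :
  (forall m, m <> n -> a m = 0) -> Series a = a n.
Proof.
intros Ha. apply is_series_unique.
assert (Hs : forall N, (n <= N)%nat -> sum_n a N = a n).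
{ intros N HN. induction N as [|N IH].
  - assert (n = O) by lia. subst n. apply sum_O.
  - rewrite sum_Sn. destruct (Nat.eq_dec n (S N)) as [->|Hne].
    + replace (sum_n a N) with 0; [unfold plus; simpl; ring|].
      symmetry. rewrite (sum_n_ext_loc a (fun _ => 0)).
      * rewrite sum_n_const. ring.
      * intros j Hj. apply Ha. lia.
    + rewrite IH by lia. rewrite (Ha (S N)) by lia. unfold plus; simpl; ring. }
apply filterlim_ext_loc with (fun _ => a n).
- exists n. intros N HN. symmetry. now apply Hs.
- apply filterlim_const.
Qed.

Lemma U_op_basis_vec (h c r : R) (n x : nat) : U_op h c r (basis_vec n) x = U_basis h c r n x.
Proof.
unfold U_op, Cseries.
rewrite (Series_single _ n), (Series_single _ n).
- unfold basis_vec. rewrite Nat.eqb_refl. rewrite Cmult_1_l.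
  unfold Re, Im. now rewrite <- surjective_pairing.
- intros m Hm. unfold basis_vec. destruct (Nat.eqb_spec m n); [easy|].
  rewrite Cmult_0_l. reflexivity.
- intros m Hm. unfold basis_vec. destruct (Nat.eqb_spec m n); [easy|].
  rewrite Cmult_0_l. reflexivity.
Qed.

(* Main.v *)
Require Import Defs.
From Stdlib Require Import Reals Lra Lia Psatz Factorial.
From Coquelicot Require Import Coquelicot.

Open Scope R_scope.

(** The functions [sigma^n C_n(x) sqrt(W(x))] form an infinite orthogonal
    matrix [A]: orthonormality of the rows follows from the contiguous relation
    [p_(n+1)(x) = p_n(x) - (x/a) p_n(x-1)] by summation by parts, and that of the
    columns from the symmetry of [2F0(-n,-x)] in [n] and [x].  An infinite matrix with
    orthonormal rows and columns is unitary on l^2, its transpose being the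
    inverse.  The three-term recurrence says that the columns of [A] are
    eigenvectors of the Jacobi matrix of the Lax operator, which therefore
    becomes multiplication by the eigenvalue.  The closure from finite vectors
    has the maximal domain of that multiplication operator because finite
    combinations of the columns form a core for the latter and, by the dual
    recurrence, a column can be truncated with vanishing boundary terms. *)

(** * Square summable real sequences *)

(** Estimates are made for real sequences only: [A] is real and the factor sqrt(W) turns L^2(N, W)
    into l^2, so a complex vector is handled as two real ones. With a = h r^2 / (4 c^2), one has 2 c
    a = h r^2 / (2c), which is the r-dependent part of C0 h. Hence the Lax matrix is 2c times the
    Charlier Jacobi matrix plus the scalar 2ck - C0 h, and its eigenvalues are 2c(x + k) - C0 h; the
    minus sign is that of pi(N) = -h. The differential equations enter through the constancy of C0,
    which makes this spectrum independent of t. The obstacle is that the eigenvectors have infinite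
    support and so lie outside the initial domain of the operator. That the closure is contained in
    the multiplication operator follows because a single coefficient of [app A] is a bounded
    functional. The converse needs approximation in the graph norm, hence decay of the columns
    against off-diagonal entries that grow like sqrt(n); this comes from n A(n,x) -> 0. *)

Definition l2 (v : nat -> R) : Prop := ex_series (fun n => v n ^ 2).

Definition dot (u v : nat -> R) : R := Series (fun n => u n * v n).

(** The index [N] itself is kept, in accordance with [sum_n f N], which has N + 1 terms. *)
Definition trunc (N : nat) (v : nat -> R) (n : nat) : R :=
  if Nat.leb n N then v n else 0.

Lemma is_series_eq (a b : nat -> R) (l : R) :
  (forall n, a n = b n) -> is_series a l -> is_series b l.
Proof. exact (@is_series_ext R_AbsRing R_NormedModule a b l). Qed.

Lemma ex_series_bound (a b : nat -> R) :
  (forall n, Rabs (a n) <= b n) -> ex_series b -> ex_series a.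
Proof. exact (@ex_series_le R_AbsRing R_CompleteNormedModule a b). Qed.

Lemma l2_dot (u v : nat -> R) : l2 u -> l2 v -> ex_series (fun n => u n * v n).
Proof.
intros Hu Hv.
apply ex_series_bound with (fun n => u n ^ 2 + v n ^ 2).
- intros n. apply Rabs_le. nra.
- exact (ex_series_plus _ _ Hu Hv).
Qed.

Lemma l2_ext (u v : nat -> R) : (forall n, u n = v n) -> l2 u -> l2 v.
Proof. intros E. apply ex_series_ext. intros n. now rewrite E. Qed.

Lemma l2_lin (a b : R) (u v : nat -> R) :
  l2 u -> l2 v -> l2 (fun n => a * u n + b * v n).
Proof.
intros Hu Hv.
apply ex_series_bound with (fun n => (2 * a ^ 2) * u n ^ 2 + (2 * b ^ 2) * v n ^ 2).
- intros n. rewrite Rabs_pos_eq by apply pow2_ge_0.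
  pose proof (pow2_ge_0 (a * u n - b * v n)). nra.
- apply (ex_series_plus (fun n => 2 * a ^ 2 * u n ^ 2) (fun n => 2 * b ^ 2 * v n ^ 2)).
  + exact (ex_series_scal (2 * a ^ 2) _ Hu).
  + exact (ex_series_scal (2 * b ^ 2) _ Hv).
Qed.

Lemma dot_ext (u u' v v' : nat -> R) :
  (forall n, u n = u' n) -> (forall n, v n = v' n) -> dot u v = dot u' v'.
Proof. intros E F. apply Series_ext. intros n. now rewrite E, F. Qed.

Lemma dot_comm (u v : nat -> R) : dot u v = dot v u.
Proof. apply Series_ext. intros n. ring. Qed.

Lemma dot_lin_l (a b : R) (u v w : nat -> R) : l2 u -> l2 v -> l2 w ->
  dot (fun n => a * u n + b * v n) w = a * dot u w + b * dot v w.
Proof.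
intros Hu Hv Hw. unfold dot.
rewrite (Series_ext _ (fun n => a * (u n * w n) + b * (v n * w n))) by (intros; ring).
rewrite (Series_plus (fun n => a * (u n * w n)) (fun n => b * (v n * w n))).
- now rewrite !Series_scal_l.
- exact (ex_series_scal a _ (l2_dot _ _ Hu Hw)).
- exact (ex_series_scal b _ (l2_dot _ _ Hv Hw)).
Qed.

Lemma dot_lin_sqr (a b : R) (u v : nat -> R) : l2 u -> l2 v ->
  dot (fun n => a * u n + b * v n) (fun n => a * u n + b * v n)
  = a ^ 2 * dot u u + 2 * a * b * dot u v + b ^ 2 * dot v v.
Proof.
intros Hu Hv. assert (Hl := l2_lin a b u v Hu Hv).
rewrite dot_lin_l by assumption.
rewrite (dot_comm u), (dot_comm v), !dot_lin_l by assumption.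
rewrite (dot_comm v u). ring.
Qed.

Lemma Series_nonneg (a : nat -> R) : (forall n, 0 <= a n) -> ex_series a -> 0 <= Series a.
Proof.
intros Ha He. rewrite <- (Rmult_0_l (Series a)), <- Series_scal_l.
apply Series_le; [intros n; rewrite Rmult_0_l; split; [lra|apply Ha]|exact He].
Qed.

Lemma l2_sqr (u : nat -> R) : l2 u -> ex_series (fun n => u n * u n).
Proof. intros Hu. now apply l2_dot. Qed.

Lemma dot_nonneg (u : nat -> R) : l2 u -> 0 <= dot u u.
Proof. intros Hu. apply Series_nonneg; [intros n; apply Rle_0_sqr|now apply l2_sqr]. Qed.

Lemma cauchy_schwarz (u v : nat -> R) : l2 u -> l2 v ->
  dot u v ^ 2 <= dot u u * dot v v.
Proof.
intros Hu Hv.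
assert (Hq : forall a b, 0 <= a ^ 2 * dot u u + 2 * a * b * dot u v + b ^ 2 * dot v v).
{ intros a b. rewrite <- dot_lin_sqr by assumption. now apply dot_nonneg, l2_lin. }
assert (Pu := dot_nonneg u Hu). assert (Pv := dot_nonneg v Hv).
destruct (Req_dec (dot v v) 0) as [E|E].
- rewrite E, Rmult_0_r. destruct (Req_dec (dot u v) 0) as [->|Q]; [lra|].
  (* With [dot v v = 0] the form is affine in its second argument, which is chosen to give the value
     -1. *)
  specialize (Hq 1 (- (dot u u + 1) / (2 * dot u v))). rewrite E in Hq.
  replace (1 ^ 2 * dot u u + 2 * 1 * (- (dot u u + 1) / (2 * dot u v)) * dot u v
           + (- (dot u u + 1) / (2 * dot u v)) ^ 2 * 0) with (-1) in Hq by (field; exact Q).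
  lra.
(* The form becomes [dot v v] times the difference of the two sides. *)
- specialize (Hq (dot v v) (- dot u v)).
  apply Rmult_le_reg_l with (dot v v); [lra|]. nra.
Qed.

Lemma is_series_trunc (f : nat -> R) (N : nat) : is_series (trunc N f) (sum_n f N).
Proof.
apply filterlim_ext_loc with (fun _ => sum_n f N).
- exists N. intros M HM. induction HM as [|M HM IH].
  + apply sum_n_ext_loc. intros n Hn. unfold trunc.
    now rewrite (proj2 (Nat.leb_le n N) Hn).
  + rewrite sum_Sn, <- IH. unfold trunc.
    rewrite (proj2 (Nat.leb_gt (S M) N)) by lia. symmetry. apply Rplus_0_r.
- apply filterlim_const.
Qed.

Lemma l2_trunc (N : nat) (v : nat -> R) : l2 (trunc N v).
Proof.
exists (sum_n (fun n => v n ^ 2) N).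
eapply is_series_eq; [|apply is_series_trunc].
intros n. unfold trunc. destruct (Nat.leb n N); ring.
Qed.

(** Squared, to keep roots out of the estimates; the price is the factor 2 in [dist2_triangle]. *)
Definition dist2 (u v : nat -> R) : R := dot (fun n => u n - v n) (fun n => u n - v n).

Lemma dot_trunc_tail (v : nat -> R) : l2 v ->
  is_lim_seq (fun N => dist2 v (trunc N v)) 0.
Proof.
intros Hv. assert (Hs := l2_sqr v Hv).
apply is_lim_seq_ext with (fun N => dot v v - sum_n (fun n => v n * v n) N).
- intros N. symmetry. apply is_series_unique.
  apply is_series_eq with (fun n => v n * v n - trunc N (fun n => v n * v n) n).
  + intros n. unfold trunc. destruct (Nat.leb n N); ring.
  + apply (is_series_minus (fun n => v n * v n)).
    * now apply Series_correct.
    * apply is_series_trunc.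
- replace 0 with (dot v v - dot v v) by ring.
  apply is_lim_seq_minus'; [apply is_lim_seq_const|].
  exact (Series_correct _ Hs).
Qed.

Lemma l2_lim0 (v : nat -> R) : l2 v -> is_lim_seq v 0.
Proof.
intros Hv. apply is_lim_seq_abs_0.
apply is_lim_seq_ext with (fun n => sqrt (v n ^ 2)).
- intros n. rewrite <- sqrt_Rsqr_abs. unfold Rsqr. f_equal. ring.
- rewrite <- sqrt_0.
  apply (filterlim_comp _ _ _ (fun n => v n ^ 2) sqrt eventually (locally 0)).
  + exact (ex_series_lim_0 _ Hv).
  + apply continuous_sqrt.
Qed.

Lemma bounded_series (a : nat -> R) (M : R) : (forall n, 0 <= a n) ->
  (forall N, sum_n a N <= M) -> ex_series a /\ Series a <= M.
Proof.
intros Ha Hb.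
assert (He : ex_series a).
{ destruct (ex_finite_lim_seq_incr (sum_n a) M) as [l Hl].
  - intros n. rewrite sum_Sn. unfold plus; simpl. specialize (Ha (S n)). lra.
  - exact Hb.
  - now exists l. }
split; [exact He|].
exact (is_lim_seq_le _ _ (Finite (Series a)) (Finite M) Hb (Series_correct _ He)
  (is_lim_seq_const M)).
Qed.

(** * Infinite orthogonal matrices *)

(** Stated with [is_series] so that convergence is included: [Series] alone has a default value on
    divergent series. *)
Definition orthonormal (A : nat -> nat -> R) : Prop :=
  forall n m, is_series (fun x => A n x * A m x) (if Nat.eqb n m then 1 else 0).

Definition tr (A : nat -> nat -> R) (x n : nat) : R := A n x.

(** Summation is over the row index, so the n-th basis vector goes to the row [A n], as [U_op] sends
    it to [U_basis h c r n]. *)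
Definition app (A : nat -> nat -> R) (v : nat -> R) (x : nat) : R := dot v (tr A x).

Lemma orthonormal_l2 (A : nat -> nat -> R) (n : nat) : orthonormal A -> l2 (A n).
Proof.
intros HA. exists 1. specialize (HA n n). rewrite Nat.eqb_refl in HA.
eapply is_series_eq; [|exact HA]. intros x. simpl. ring.
Qed.

Lemma orthonormal_dot (A : nat -> nat -> R) (n : nat) : orthonormal A -> dot (A n) (A n) = 1.
Proof.
intros HA. apply is_series_unique. specialize (HA n n). now rewrite Nat.eqb_refl in HA.
Qed.

Lemma app_ext (A : nat -> nat -> R) (u v : nat -> R) (x : nat) :
  (forall n, u n = v n) -> app A u x = app A v x.
Proof. intros E. now apply dot_ext. Qed.

Lemma app_lin (A : nat -> nat -> R) (a b : R) (u v : nat -> R) (x : nat) :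
  orthonormal (tr A) -> l2 u -> l2 v ->
  app A (fun n => a * u n + b * v n) x = a * app A u x + b * app A v x.
Proof. intros HA Hu Hv. apply dot_lin_l; auto. now apply orthonormal_l2. Qed.

(** Each column is a unit vector. This is the device by which pointwise identities pass to l^2
    limits. *)
Lemma app_point_bound (A : nat -> nat -> R) (v : nat -> R) (x : nat) :
  orthonormal (tr A) -> l2 v -> app A v x ^ 2 <= dot v v.
Proof.
intros HA Hv.
rewrite <- (Rmult_1_r (dot v v)), <- (orthonormal_dot (tr A) x HA).
apply cauchy_schwarz; auto. now apply orthonormal_l2.
Qed.

Lemma app_trunc (A : nat -> nat -> R) (N : nat) (v : nat -> R) (x : nat) :
  app A (trunc N v) x = sum_n (fun n => v n * A n x) N.
Proof.
apply is_series_unique. eapply is_series_eq; [|apply is_series_trunc].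
intros n. unfold trunc, tr. destruct (Nat.leb n N); simpl; ring.
Qed.

Lemma partial_dot_row (A : nat -> nat -> R) (v : nat -> R) (N m : nat) : orthonormal A ->
  is_series (fun x => sum_n (fun n => v n * A n x) N * A m x) (trunc N v m).
Proof.
intros HA. induction N as [|N IH].
- apply is_series_eq with (fun x => v O * (A O x * A m x)).
  + intros x. rewrite sum_O. simpl. ring.
  + replace (trunc 0 v m) with (v O * (if Nat.eqb 0 m then 1 else 0)).
    * exact (is_series_scal (v O) _ _ (HA O m)).
    * destruct m; unfold trunc; simpl; ring.
- apply is_series_eq with
    (fun x => sum_n (fun n => v n * A n x) N * A m x + v (S N) * (A (S N) x * A m x)).
  + intros x. rewrite sum_Sn. unfold plus; simpl. ring.
  + replace (trunc (S N) v m)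
      with (trunc N v m + v (S N) * (if Nat.eqb (S N) m then 1 else 0)).
    * exact (is_series_plus _ _ _ _ IH (is_series_scal (v (S N)) _ _ (HA (S N) m))).
    * unfold trunc. destruct (Nat.eqb_spec (S N) m), (Nat.leb_spec m N),
        (Nat.leb_spec m (S N)); subst; try lia; try ring.
Qed.

Lemma partial_norm (A : nat -> nat -> R) (v : nat -> R) (N : nat) : orthonormal A ->
  is_series (fun x => sum_n (fun n => v n * A n x) N ^ 2) (sum_n (fun n => v n ^ 2) N).
Proof.
intros HA. induction N as [|N IH].
- apply is_series_eq with (fun x => v O * (sum_n (fun n => v n * A n x) 0 * A O x)).
  + intros x. rewrite sum_O. simpl. ring.
  + rewrite sum_O. replace (v O ^ 2) with (v O * trunc 0 v 0) by (unfold trunc; simpl; ring).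
    exact (is_series_scal (v O) _ _ (partial_dot_row A v 0 0 HA)).
(* With p and q the sums up to N and N + 1, and row = [A (S N)]: q^2 = p^2 + v(N+1) p row + v(N+1) q
   row. Against that row, p sums to 0 and q to v(N+1). *)
- assert (H1 := is_series_scal (v (S N)) _ _ (partial_dot_row A v N (S N) HA)).
  assert (H2 := is_series_scal (v (S N)) _ _ (partial_dot_row A v (S N) (S N) HA)).
  assert (H3 := is_series_plus _ _ _ _ IH (is_series_plus _ _ _ _ H1 H2)).
  unfold trunc in H3. rewrite Nat.leb_refl, (proj2 (Nat.leb_gt (S N) N)) in H3 by lia.
  rewrite sum_Sn.
  match type of H3 with is_series _ ?l =>
    replace (plus (sum_n (fun n => v n ^ 2) N) (v (S N) ^ 2)) with l end.
  + eapply is_series_eq; [|exact H3]. intros x. rewrite !sum_Sn.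
    unfold plus, scal; simpl. unfold mult; simpl. ring.
  + unfold plus, scal; simpl. unfold mult; simpl. ring.
Qed.

(** A Fatou argument: [partial_norm] bounds the sum over x <= X of squared partial sums by the norm
    of [v]; N tends to infinity for fixed X, and only then X. The columns being in l^2 gives the
    pointwise convergence in N. *)
Lemma app_contraction (A : nat -> nat -> R) (v : nat -> R) :
  orthonormal A -> orthonormal (tr A) -> l2 v ->
  l2 (app A v) /\ dot (app A v) (app A v) <= dot v v.
Proof.
intros HA HB Hv.
destruct (bounded_series (fun x => app A v x ^ 2) (dot v v)) as [He Hle].
- intros x. apply pow2_ge_0.
- intros X.
  assert (HL : is_lim_seq (fun N => sum_n (fun x => sum_n (fun n => v n * A n x) N ^ 2) X)
            (sum_n (fun x => app A v x ^ 2) X)).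
  { assert (Hx : forall x, is_lim_seq (fun N => sum_n (fun n => v n * A n x) N ^ 2)
                   (app A v x ^ 2)).
    { intros x.
      assert (H1 : is_lim_seq (fun N => sum_n (fun n => v n * A n x) N) (app A v x)).
      { apply (Series_correct (fun n => v n * A n x)).
        apply l2_dot; auto. exact (orthonormal_l2 (tr A) x HB). }
      eapply is_lim_seq_ext; [|replace (app A v x ^ 2) with (app A v x * app A v x) by ring;
        exact (is_lim_seq_mult' _ _ _ _ H1 H1)].
      intros N. simpl. ring. }
    induction X as [|X IH].
    - rewrite sum_O. eapply is_lim_seq_ext; [|apply Hx]. intros N. now rewrite sum_O.
    - rewrite sum_Sn. eapply is_lim_seq_ext; [|exact (is_lim_seq_plus' _ _ _ _ IH (Hx (S X)))].
      intros N. now rewrite sum_Sn. }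
  assert (HU : forall (a : nat -> R) l N, (forall n, 0 <= a n) -> is_series a l -> sum_n a N <= l).
  { intros a l N Ha Hl.
    apply (is_lim_seq_incr_compare (sum_n a) l Hl).
    intros n. rewrite sum_Sn. unfold plus; simpl. specialize (Ha (S n)). lra. }
  apply (is_lim_seq_le _ (fun _ => dot v v) _ (Finite (dot v v))) with (2 := HL).
  2: apply is_lim_seq_const.
  intros N. apply Rle_trans with (sum_n (fun n => v n ^ 2) N).
  + apply HU; [intros x; apply pow2_ge_0|now apply partial_norm].
  + apply HU; [intros x; apply pow2_ge_0|].
    apply is_series_eq with (fun n => v n * v n); [intros; simpl; ring|].
    now apply Series_correct, l2_sqr.
- split; [exact He|]. eapply Rle_trans; [|exact Hle]. apply Req_le.
  apply Series_ext. intros x. ring.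
Qed.

Lemma sqr_le_lim0 (d : R) (e : nat -> R) (N0 : nat) :
  (forall N, (N0 <= N)%nat -> d ^ 2 <= e N) -> is_lim_seq e 0 -> d = 0.
Proof.
intros Hd He.
assert (d ^ 2 <= 0).
{ apply (is_lim_seq_le_loc (fun _ => d ^ 2) e (Finite (d ^ 2)) (Finite 0)).
  - now exists N0.
  - apply is_lim_seq_const.
  - exact He. }
nra.
Qed.

(** On a truncation at N >= m the identity at m is orthonormality of the rows. The remainder [w]
    contributes at most its own norm, by the contraction and the point bound, and that norm tends to
    0. *)
Lemma app_tr_app (A : nat -> nat -> R) (v : nat -> R) (m : nat) :
  orthonormal A -> orthonormal (tr A) -> l2 v -> app (tr A) (app A v) m = v m.
Proof.
intros HA HB Hv.
apply Rminus_diag_uniq.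
apply sqr_le_lim0 with (2 := dot_trunc_tail v Hv) (N0 := m).
intros N HN.
set (w := fun n => v n - trunc N v n).
assert (Hw : l2 w).
{ apply l2_ext with (fun n => 1 * v n + (-1) * trunc N v n); [intros; unfold w; ring|].
  apply l2_lin; auto. apply l2_trunc. }
destruct (app_contraction A w HA HB Hw) as [Haw Hle].
destruct (app_contraction A v HA HB Hv) as [Hav _].
destruct (app_contraction A (trunc N v) HA HB (l2_trunc N v)) as [Hat _].
apply Rle_trans with (2 := Hle).
replace (app (tr A) (app A v) m - v m) with (app (tr A) (app A w) m).
- now apply app_point_bound.
- rewrite (app_ext _ _ (fun x => 1 * app A v x + (-1) * app A (trunc N v) x)).
  + rewrite app_lin by assumption.
    replace (app (tr A) (app A (trunc N v)) m) with (v m); [ring|].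
    symmetry. apply is_series_unique.
    replace (v m) with (trunc N v m).
    * eapply is_series_eq; [|exact (partial_dot_row A v N m HA)].
      intros x. now rewrite app_trunc.
    * unfold trunc. now rewrite (proj2 (Nat.leb_le m N) HN).
  + intros x. rewrite <- app_lin by (auto; apply l2_trunc).
    apply app_ext. intros n. unfold w. ring.
Qed.

(** A contraction whose inverse is also a contraction preserves norms; polarisation with [v + w]
    then gives the inner product. *)
Lemma app_dot (A : nat -> nat -> R) (v w : nat -> R) :
  orthonormal A -> orthonormal (tr A) -> l2 v -> l2 w ->
  dot (app A v) (app A w) = dot v w.
Proof.
intros HA HB.
assert (Hn : forall v, l2 v -> dot (app A v) (app A v) = dot v v).
{ clear v w. intros v Hv. destruct (app_contraction A v HA HB Hv) as [Hav H1].
  apply Rle_antisym; [exact H1|].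
  rewrite <- (dot_ext _ _ _ _ (fun n => app_tr_app A v n HA HB Hv)
                      (fun n => app_tr_app A v n HA HB Hv)).
  now apply (app_contraction (tr A) (app A v) HB HA). }
intros Hv Hw.
destruct (app_contraction A v HA HB Hv) as [Hav _].
destruct (app_contraction A w HA HB Hw) as [Haw _].
assert (E := Hn _ (l2_lin 1 1 v w Hv Hw)).
rewrite (dot_ext _ (fun x => 1 * app A v x + 1 * app A w x)
                 _ (fun x => 1 * app A v x + 1 * app A w x)) in E
  by (intros x; now apply app_lin).
rewrite !dot_lin_sqr, !Hn in E by assumption. lra.
Qed.

(** * Orthogonality of the Charlier polynomials *)

Lemma poch_shift (b : R) (j : nat) : poch b (S j) = b * poch (b + 1) j.
Proof.
induction j as [|j IH]; [simpl; ring|].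
change (poch b (S (S j))) with (poch b (S j) * (b + INR (S j))).
rewrite IH, S_INR. simpl. ring.
Qed.

Lemma poch_neg_vanish (n j : nat) : (n < j)%nat -> poch (- INR n) j = 0.
Proof.
intros Hj. induction Hj as [|j Hj IH]; simpl.
- ring.
- rewrite IH. ring.
Qed.

(** Padding with vanishing terms lets sums of different lengths be compared term by term. *)
Lemma hyp2F0_neg_extend (n M : nat) (b z : R) : (n <= M)%nat ->
  sum_n (fun j => poch (- INR n) j * poch b j / INR (fact j) * z ^ j) M = hyp2F0_neg n b z.
Proof.
intros HM. induction HM as [|M HM IH]; [reflexivity|].
rewrite sum_Sn, IH, poch_neg_vanish by lia. unfold plus; simpl. unfold Rdiv. ring.
Qed.

Lemma hyp2F0_neg_sym (n x : nat) (z : R) :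
  hyp2F0_neg n (- INR x) z = hyp2F0_neg x (- INR n) z.
Proof.
rewrite <- (hyp2F0_neg_extend n (n + x)), <- (hyp2F0_neg_extend x (n + x)) by lia.
apply sum_n_ext. intros j. now rewrite (Rmult_comm (poch (- INR n) j)).
Qed.

(** Termwise: (-n-1)_(j+1) - (-n)_(j+1) = -(j+1) (-n)_j, where j + 1 cancels against (j+1)!, and
    (b)_(j+1) = b (b+1)_j. *)
Lemma hyp2F0_neg_succ (n : nat) (b z : R) :
  hyp2F0_neg (S n) b z = hyp2F0_neg n b z - b * z * hyp2F0_neg n (b + 1) z.
Proof.
set (t := fun n b j => poch (- INR n) j * poch b j / INR (fact j) * z ^ j).
assert (Ht : forall j, t (S n) b (S j) = t n b (S j) - b * z * t n (b + 1) j).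
{ intros j. unfold t. rewrite (poch_shift b), (poch_shift (- INR (S n))).
  replace (- INR (S n) + 1) with (- INR n) by (rewrite S_INR; ring).
  change (poch (- INR n) (S j)) with (poch (- INR n) j * (- INR n + INR j)).
  change (fact (S j)) with (S j * fact j)%nat.
  change (z ^ S j) with (z * z ^ j). rewrite mult_INR, !S_INR.
  pose proof (INR_fact_neq_0 j). pose proof (pos_INR j). field. split; lra. }
assert (HM : forall M, sum_n (t (S n) b) (S M)
               = sum_n (t n b) (S M) - b * z * sum_n (t n (b + 1)) M).
{ intros M. induction M as [|M IH].
  - rewrite !sum_Sn, !sum_O, Ht. unfold plus; simpl.
    replace (t (S n) b O) with (t n b O) by reflexivity. ring.
  - rewrite (sum_Sn _ (S M)), IH, Ht, (sum_Sn _ (S M)), (sum_Sn (t n (b + 1)) M).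
    unfold plus; simpl. ring. }
rewrite <- (hyp2F0_neg_extend n (S n)) by lia. apply HM.
Qed.

(** The Charlier polynomial without its normalising root, which would destroy the symmetry in n and
    x. *)
Definition cpoly (a : R) (n x : nat) : R := hyp2F0_neg n (- INR x) (- (1 / a)).

Lemma cpoly_sym (a : R) (n x : nat) : cpoly a n x = cpoly a x n.
Proof. apply hyp2F0_neg_sym. Qed.

Lemma cpoly_0 (a : R) (x : nat) : cpoly a 0 x = 1.
Proof. unfold cpoly, hyp2F0_neg. rewrite sum_O. simpl. field. Qed.

(** At x = 0 the value [pred 0 = 0] is harmless, since its coefficient vanishes. *)
Lemma cpoly_succ_l (a : R) (n x : nat) :
  cpoly a (S n) x = cpoly a n x - INR x / a * cpoly a n (pred x).
Proof.
unfold cpoly. rewrite hyp2F0_neg_succ. destruct x as [|x].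
- simpl. unfold Rdiv. ring.
- replace (- INR (S x) + 1) with (- INR (pred (S x))) by (rewrite S_INR; simpl; ring).
  unfold Rdiv. ring.
Qed.

Lemma cpoly_succ_r (a : R) (n x : nat) :
  cpoly a n (S x) = cpoly a n x - INR n / a * cpoly a (pred n) x.
Proof. rewrite (cpoly_sym a n (S x)), cpoly_succ_l. now rewrite !(cpoly_sym a x). Qed.

(** Eliminating C_(n+1) leaves (x - n) C_n(x) = x C_n(x-1) - n C_(n-1)(x). By the two relations
    above, C_n(x-1) and C_(n-1)(x) are C_n(x) plus n/a, respectively x/a, times C_(n-1)(x-1), and
    these extra terms cancel. *)
Lemma cpoly_rec (a : R) (n x : nat) : a <> 0 ->
  INR x * cpoly a n x
  = - a * cpoly a (S n) x + (INR n + a) * cpoly a n x - INR n * cpoly a (pred n) x.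
Proof.
intros Ha. rewrite cpoly_succ_l.
destruct n as [|n].
- rewrite !cpoly_0. simpl. field. exact Ha.
- destruct x as [|x].
  + rewrite !(cpoly_sym a _ 0), !cpoly_0. simpl pred. simpl (INR 0). field. exact Ha.
  + assert (Hl := cpoly_succ_l a n (S x)). assert (Hr := cpoly_succ_r a (S n) x).
    simpl pred in *.
    replace (cpoly a n (S x)) with (cpoly a (S n) (S x) + INR (S x) / a * cpoly a n x)
      by (rewrite Hl; ring).
    replace (cpoly a (S n) x) with (cpoly a (S n) (S x) + INR (S n) / a * cpoly a n x)
      by (rewrite Hr; ring).
    field. exact Ha.
Qed.

(** * Growth of the polynomials and convergence of the moments *)

(** A class closed under products whose members the factorial in the Poisson weight always beats. *)
Definition exp_bounded (f : nat -> R) : Prop :=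
  exists M b, 0 <= M /\ 1 <= b /\ forall x, Rabs (f x) <= M * b ^ x.

Lemma exp_bounded_mult (f g : nat -> R) :
  exp_bounded f -> exp_bounded g -> exp_bounded (fun x => f x * g x).
Proof.
intros (M & b & HM & Hb & Hf) (M' & b' & HM' & Hb' & Hg).
exists (M * M'), (b * b'). repeat split; [nra|nra|].
intros x. rewrite Rabs_mult, Rpow_mult_distr.
replace (M * M' * (b ^ x * b' ^ x)) with ((M * b ^ x) * (M' * b' ^ x)) by ring.
apply Rmult_le_compat; auto using Rabs_pos.
Qed.

Lemma INR_le_pow2 (x : nat) : INR x <= 2 ^ x.
Proof.
induction x as [|x IH]; [simpl; lra|]. rewrite S_INR.
pose proof (pow_R1_Rle 2 x ltac:(lra)). simpl. lra.
Qed.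

Lemma cpoly_exp_bounded (a : R) (n : nat) : 0 < a -> exp_bounded (cpoly a n).
Proof.
intros Ha. induction n as [|n (M & b & HM & Hb & IH)].
- exists 1, 1. repeat split; try lra. intros x. rewrite cpoly_0, Rabs_R1, pow1. lra.
(* From [cpoly_succ_l]: the factor x is absorbed by 2^x, and 1/a is added to the constant. *)
- exists (M * (1 + / a)), (2 * b). assert (0 < / a) by now apply Rinv_0_lt_compat.
  repeat split; [nra|lra|]. intros x. rewrite cpoly_succ_l.
  eapply Rle_trans; [apply Rabs_triang|].
  rewrite Rabs_Ropp, Rabs_mult, (Rabs_pos_eq (INR x / a)).
  2:{ apply Rmult_le_pos; [apply pos_INR|lra]. }
  assert (H1 := IH x). assert (H2 := IH (pred x)).
  assert (Hp : b ^ pred x <= b ^ x) by (apply Rle_pow; [lra|lia]).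
  assert (H0 : 1 <= b ^ x) by now apply pow_R1_Rle.
  assert (Hx := INR_le_pow2 x). assert (H2x : 1 <= 2 ^ x) by (apply pow_R1_Rle; lra).
  assert (Hnx := pos_INR x).
  rewrite Rpow_mult_distr.
  assert (HB : Rabs (cpoly a n (pred x)) <= M * b ^ x).
  { eapply Rle_trans; [exact H2|]. now apply Rmult_le_compat_l. }
  assert (HMb : 0 <= M * b ^ x) by nra.
  assert (HX : INR x / a * Rabs (cpoly a n (pred x)) <= (2 ^ x * / a) * (M * b ^ x)).
  { apply Rmult_le_compat; auto using Rabs_pos.
    - apply Rmult_le_pos; lra.
    - apply Rmult_le_compat_r; lra. }
  assert (M * b ^ x <= 2 ^ x * (M * b ^ x)) by nra.
  lra.
Qed.

Lemma is_series_exp (a : R) : is_series (fun x => a ^ x / INR (fact x)) (exp a).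
Proof.
eapply is_series_eq; [|exact (is_exp_Reals a)].
intros n. rewrite pow_n_pow. reflexivity.
Qed.

Lemma ex_series_exp_bounded (a : R) (f : nat -> R) : 0 < a -> exp_bounded f ->
  ex_series (fun x => f x * (a ^ x / INR (fact x))).
Proof.
intros Ha (M & b & HM & Hb & Hf).
apply ex_series_bound with (fun x => M * ((b * a) ^ x / INR (fact x))).
- intros x.
  assert (0 < / INR (fact x)) by apply Rinv_0_lt_compat, INR_fact_lt_0.
  assert (0 < a ^ x) by now apply pow_lt.
  rewrite Rabs_mult, (Rabs_pos_eq (a ^ x / _)) by (apply Rmult_le_pos; lra).
  rewrite Rpow_mult_distr.
  replace (M * (b ^ x * a ^ x / INR (fact x))) with ((M * b ^ x) * (a ^ x / INR (fact x)))
    by (unfold Rdiv; ring).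
  apply Rmult_le_compat_r; [apply Rmult_le_pos; lra|apply Hf].
- exact (ex_series_scal M _ (ex_intro _ _ (is_series_exp (b * a)))).
Qed.

Definition moment (a : R) (n m : nat) : R :=
  Series (fun x => cpoly a n x * cpoly a m x * (a ^ x / INR (fact x))).

Lemma ex_moment (a : R) (n m : nat) : 0 < a ->
  ex_series (fun x => cpoly a n x * cpoly a m x * (a ^ x / INR (fact x))).
Proof.
intros Ha. apply (ex_series_exp_bounded a (fun x => cpoly a n x * cpoly a m x) Ha).
apply exp_bounded_mult; now apply cpoly_exp_bounded.
Qed.

Lemma moment_sym (a : R) (n m : nat) : moment a n m = moment a m n.
Proof. apply Series_ext. intros x. ring. Qed.

(* Summation by parts: [cpoly_succ_l] lowers [x] in the first factor, and
   [x/a * a^x/x! = a^(x-1)/(x-1)!] moves the shift to the second one. *)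
Lemma moment_succ (a : R) (n m : nat) : 0 < a ->
  moment a (S n) m = INR m / a * moment a n (pred m).
Proof.
intros Ha.
set (w := fun x => a ^ x / INR (fact x)).
set (g := fun x => INR x / a * cpoly a n (pred x) * cpoly a m x * w x).
assert (Hg : forall x, g (S x) = cpoly a n x * cpoly a m x * w x
                        - INR m / a * (cpoly a n x * cpoly a (pred m) x * w x)).
{ intros x. unfold g. rewrite (cpoly_succ_r a m x). simpl pred.
  replace (w (S x)) with (a / INR (S x) * w x).
  - field. split; [lra|]. apply not_0_INR. lia.
  - unfold w. change (fact (S x)) with (S x * fact x)%nat. rewrite mult_INR. simpl pow.
    field. split; [apply INR_fact_neq_0|apply not_0_INR; lia]. }
assert (He1 := ex_moment a n m Ha). assert (He2 := ex_moment a n (pred m) Ha).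
assert (He3 := ex_series_scal (INR m / a) _ He2).
assert (Hex : ex_series g).
{ apply ex_series_incr_1. eapply ex_series_ext; [intros x; symmetry; apply Hg|].
  exact (ex_series_minus _ _ He1 He3). }
assert (HG : Series g = moment a n m - INR m / a * moment a n (pred m)).
{ rewrite Series_incr_1 by exact Hex.
  replace (g O) with 0 by (unfold g; simpl; unfold Rdiv; ring).
  rewrite (Series_ext _ _ Hg), Series_minus by assumption.
  rewrite Series_scal_l. apply Rplus_0_l. }
unfold moment at 1.
rewrite (Series_ext _ (fun x => cpoly a n x * cpoly a m x * w x - g x)).
- rewrite Series_minus by assumption. rewrite HG.
  change (moment a n m - (moment a n m - INR m / a * moment a n (pred m))
          = INR m / a * moment a n (pred m)). ring.
- intros x. rewrite cpoly_succ_l. unfold g, w. ring.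
Qed.

(** [moment_succ] lowers both indices at once. Unequal ones meet a factor [INR 0]; equal ones
    collect n!/a^n on the way down to [moment a 0 0 = exp a]. *)
Lemma moment_value (a : R) (n m : nat) : 0 < a ->
  moment a n m = if Nat.eqb n m then INR (fact n) / a ^ n * exp a else 0.
Proof.
intros Ha. revert m. induction n as [|n IH]; intros m.
- destruct m as [|m].
  + unfold moment. rewrite (Series_ext _ (fun x => a ^ x / INR (fact x))).
    * rewrite (is_series_unique _ _ (is_series_exp a)). simpl. field.
    * intros x. rewrite cpoly_0. ring.
  + rewrite moment_sym, moment_succ by exact Ha. simpl. unfold Rdiv. ring.
- rewrite moment_succ by exact Ha. destruct m as [|m]; simpl pred; simpl Nat.eqb.
  + simpl. unfold Rdiv. ring.
  + rewrite IH. destruct (Nat.eqb_spec n m) as [->|]; [|ring].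
    change (fact (S m)) with (S m * fact m)%nat. rewrite mult_INR.
    simpl pow. field. split; [apply pow_nonzero|]; lra.
Qed.

(** * Squared distances in l^2 *)

Lemma dist2_ext (u u' v v' : nat -> R) :
  (forall n, u n = u' n) -> (forall n, v n = v' n) -> dist2 u v = dist2 u' v'.
Proof. intros E F. apply dot_ext; intros n; now rewrite E, F. Qed.

Lemma dist2_sym (u v : nat -> R) : dist2 u v = dist2 v u.
Proof. apply Series_ext. intros n. ring. Qed.

Lemma l2_minus (u v : nat -> R) : l2 u -> l2 v -> l2 (fun n => u n - v n).
Proof.
intros Hu Hv. apply l2_ext with (fun n => 1 * u n + (-1) * v n); [intros; ring|].
now apply l2_lin.
Qed.

Lemma dot_plus_le (u v : nat -> R) : l2 u -> l2 v ->
  dot (fun n => u n + v n) (fun n => u n + v n) <= 2 * dot u u + 2 * dot v v.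
Proof.
intros Hu Hv.
rewrite (dot_ext _ (fun n => 1 * u n + 1 * v n) _ (fun n => 1 * u n + 1 * v n))
  by (intros; ring).
assert (H := dot_nonneg _ (l2_lin 1 (-1) u v Hu Hv)).
rewrite dot_lin_sqr in * by assumption. lra.
Qed.

Lemma dist2_triangle (u v w : nat -> R) : l2 u -> l2 v -> l2 w ->
  dist2 u w <= 2 * dist2 u v + 2 * dist2 v w.
Proof.
intros Hu Hv Hw.
eapply Rle_trans; [|apply dot_plus_le; now apply l2_minus].
apply Req_le, dot_ext; intros; ring.
Qed.

Lemma app_minus (A : nat -> nat -> R) (u v : nat -> R) (x : nat) :
  orthonormal (tr A) -> l2 u -> l2 v ->
  app A (fun n => u n - v n) x = app A u x - app A v x.
Proof.
intros HA Hu Hv. rewrite (app_ext _ _ (fun n => 1 * u n + (-1) * v n)) by (intros; ring).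
rewrite app_lin by assumption. ring.
Qed.

Lemma dist2_app (A : nat -> nat -> R) (u v : nat -> R) :
  orthonormal A -> orthonormal (tr A) -> l2 u -> l2 v ->
  dist2 (app A u) (app A v) = dist2 u v.
Proof.
intros HA HB Hu Hv. unfold dist2.
rewrite <- (app_dot A (fun n => u n - v n)) by (auto; now apply l2_minus).
apply dot_ext; intros x; symmetry; now apply app_minus.
Qed.

(** * Jacobi operators *)

Definition finsupp (v : nat -> R) : Prop := exists n0 : nat, forall n, (n0 <= n)%nat -> v n = 0.

Lemma finsupp_l2 (v : nat -> R) : finsupp v -> l2 v.
Proof.
intros [n0 Hv]. apply l2_ext with (2 := l2_trunc n0 v).
intros n. unfold trunc. destruct (Nat.leb_spec n n0); [easy|]. symmetry. apply Hv. lia.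
Qed.

Lemma finsupp_trunc (N : nat) (v : nat -> R) : finsupp (trunc N v).
Proof.
exists (S N). intros n Hn. unfold trunc. now rewrite (proj2 (Nat.leb_gt n N)) by lia.
Qed.

(** Defined on all sequences, since an entry involves at most three terms; the same formula serves
    for finite vectors and for the columns of [A]. The entry [b n] couples n and n + 1. *)
Definition jacobi (d b : nat -> R) (v : nat -> R) (n : nat) : R :=
  d n * v n + match n with O => 0 | S m => b m * v m end + b n * v (S n).

Lemma jacobi_ext (d b u v : nat -> R) (n : nat) :
  (forall m, u m = v m) -> jacobi d b u n = jacobi d b v n.
Proof. intros E. unfold jacobi. destruct n; now rewrite !E. Qed.

Lemma finsupp_jacobi (d b v : nat -> R) : finsupp v -> finsupp (jacobi d b v).
Proof.
intros [n0 Hv]. exists (S n0). intros n Hn. unfold jacobi.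
destruct n as [|n]; [lia|]. rewrite !Hv by lia. ring.
Qed.

(** Discrete Green formula: the diagonal cancels and the rest telescopes to the Wronskian at the
    cut. *)
Lemma jacobi_green (d b u v : nat -> R) (N : nat) :
  b N * (u (S N) * v N - u N * v (S N))
  = sum_n (fun n => jacobi d b u n * v n - u n * jacobi d b v n) N.
Proof.
induction N as [|N IH].
- rewrite sum_O. unfold jacobi. ring.
- rewrite sum_Sn, <- IH. unfold jacobi, plus; simpl. ring.
Qed.

Definition eigen (d b : nat -> R) (A : nat -> nat -> R) (f : nat -> R) : Prop :=
  forall x n, jacobi d b (tr A x) n = f x * A n x.

(** Symmetry of the Jacobi matrix, tested on a column: the partial sums of the difference are the
    boundary terms of [jacobi_green], zero beyond the support of [v]. *)
Lemma app_jacobi (d b : nat -> R) (A : nat -> nat -> R) (f v : nat -> R) (x : nat) :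
  orthonormal (tr A) -> eigen d b A f -> finsupp v ->
  app A (jacobi d b v) x = f x * app A v x.
Proof.
intros HB HE Hv.
assert (Hx := orthonormal_l2 (tr A) x HB).
assert (H1 := l2_dot _ _ (finsupp_l2 v Hv) Hx).
assert (H2 := l2_dot _ _ (finsupp_l2 _ (finsupp_jacobi d b v Hv)) Hx).
apply Rminus_diag_uniq. unfold app, dot.
rewrite <- Series_scal_l, <- Series_minus; [|exact H2|exact (ex_series_scal (f x) _ H1)].
apply is_series_unique.
apply is_series_eq with (fun n => jacobi d b v n * tr A x n - v n * jacobi d b (tr A x) n).
- intros n. rewrite HE. unfold tr. ring.
- destruct Hv as [n0 Hv].
  apply filterlim_ext_loc with (fun _ => 0); [|apply filterlim_const].
  exists n0. intros N HN. rewrite <- jacobi_green, !Hv by lia. ring.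
Qed.

Lemma is_lim_seq_inv_S : is_lim_seq (fun n => / INR (S n)) 0.
Proof.
apply (is_lim_seq_incr_1 (fun n => / INR n)).
apply (is_lim_seq_inv INR p_infty); [apply is_lim_seq_INR|easy].
Qed.

(** For fixed x both sides are continuous in the l^2 norm, so [app_jacobi] survives the closure even
    though [f] may be unbounded. *)
Lemma closure_eigen (d b : nat -> R) (A : nat -> nat -> R) (f v w : nat -> R) (x : nat) :
  orthonormal (tr A) -> eigen d b A f -> l2 v -> l2 w ->
  (forall eps, 0 < eps -> exists v', finsupp v' /\
     dist2 v' v < eps /\ dist2 (jacobi d b v') w < eps) ->
  app A w x = f x * app A v x.
Proof.
intros HB HE Hv Hw Hc. apply Rminus_diag_uniq.
(* The bound is (f p - q)^2 <= 2 f^2 p^2 + 2 q^2, with p^2 and q^2 below 1/(N+1). *)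
apply (sqr_le_lim0 _ (fun N => (2 + 2 * f x ^ 2) * / INR (S N)) 0).
- intros N _.
  destruct (Hc (/ INR (S N))) as (v' & Fv' & D1 & D2).
  { apply Rinv_0_lt_compat, lt_0_INR. lia. }
  assert (Hv' := finsupp_l2 v' Fv').
  assert (Hj := finsupp_l2 _ (finsupp_jacobi d b v' Fv')).
  assert (P1 := app_point_bound A _ x HB (l2_minus _ _ Hv' Hv)).
  assert (P2 := app_point_bound A _ x HB (l2_minus _ _ Hj Hw)).
  fold (dist2 v' v) in P1. fold (dist2 (jacobi d b v') w) in P2.
  rewrite app_minus in P1, P2 by assumption.
  rewrite (app_jacobi d b A f) in P2 by assumption.
  set (p := app A v' x - app A v x) in *.
  set (q := f x * app A v' x - app A w x) in *.
  replace (app A w x - f x * app A v x) with (f x * p - q) by (unfold p, q; ring).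
  assert (0 <= f x ^ 2) by apply pow2_ge_0.
  apply Rle_trans with (2 * f x ^ 2 * p ^ 2 + 2 * q ^ 2).
  + pose proof (pow2_ge_0 (f x * p + q)). nra.
  + assert (f x ^ 2 * p ^ 2 <= f x ^ 2 * / INR (S N)) by (apply Rmult_le_compat_l; lra).
    lra.
- replace 0 with ((2 + 2 * f x ^ 2) * 0) by ring.
  exact (is_lim_seq_scal_l _ _ (Finite 0) is_lim_seq_inv_S).
Qed.

Definition unit_vec (N n : nat) : R := if Nat.eqb n N then 1 else 0.

Lemma l2_unit_vec (N : nat) : l2 (unit_vec N).
Proof.
apply finsupp_l2. exists (S N). intros n Hn. unfold unit_vec.
destruct (Nat.eqb_spec n N); [lia|easy].
Qed.

Lemma dot_unit_vec (N M : nat) : dot (unit_vec N) (unit_vec M) = unit_vec N M.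
Proof.
unfold dot. rewrite (Series_single _ M).
- unfold unit_vec. rewrite Nat.eqb_refl. ring.
- intros m Hm. unfold unit_vec at 2. destruct (Nat.eqb_spec m M); [easy|ring].
Qed.

(** Truncating before or after applying the matrix differs at two positions only: by b_N z_(N+1) at
    N and by b_N z_N at N + 1. These are the entries of [bd]. *)
Lemma jacobi_trunc_lim (d b z : nat -> R) : l2 (jacobi d b z) ->
  is_lim_seq (fun n => b n * z n) 0 -> is_lim_seq (fun n => b n * z (S n)) 0 ->
  is_lim_seq (fun N => dist2 (jacobi d b (trunc N z)) (jacobi d b z)) 0.
Proof.
intros Hj L1 L2.
set (tail := fun N n => jacobi d b z n - trunc N (jacobi d b z) n).
set (bd := fun N n => b N * z (S N) * unit_vec N n + - (b N * z N) * unit_vec (S N) n).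
assert (E : forall N n, jacobi d b z n - jacobi d b (trunc N z) n = tail N n + bd N n).
{ intros N n. unfold tail, bd, trunc, unit_vec, jacobi.
  destruct n as [|n].
  - destruct (Nat.leb_spec 0 N), (Nat.leb_spec 1 N), (Nat.eqb_spec 0 N), (Nat.eqb_spec 0 (S N));
      subst; try lia; ring.
  - destruct (Nat.leb_spec (S n) N), (Nat.leb_spec n N), (Nat.leb_spec (S (S n)) N),
      (Nat.eqb_spec (S n) N), (Nat.eqb_spec (S n) (S N)); try lia;
      try (replace N with (S n) by lia); try (replace N with n by lia); ring. }
assert (Hu := l2_unit_vec).
apply (is_lim_seq_le_le (fun _ => 0) _
  (fun N => 2 * dist2 (jacobi d b z) (trunc N (jacobi d b z))
     + 2 * ((b N * z (S N)) * (b N * z (S N)) + (b N * z N) * (b N * z N)))).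
- intros N.
  assert (Hb : l2 (bd N)) by (now apply l2_lin).
  assert (Ht : l2 (tail N)) by (apply l2_minus; auto; apply l2_trunc).
  rewrite dist2_sym. unfold dist2 at 1 2. split.
  + apply dot_nonneg.
    apply l2_ext with (fun n => 1 * tail N n + 1 * bd N n); [|now apply l2_lin].
    intros n. rewrite E. ring.
  + rewrite (dot_ext _ _ _ _ (E N) (E N)).
    eapply Rle_trans; [now apply dot_plus_le|].
    unfold bd at 1 2. rewrite dot_lin_sqr, !dot_unit_vec by apply Hu.
    unfold unit_vec. rewrite !Nat.eqb_refl.
    rewrite (proj2 (Nat.eqb_neq (S N) N)) by lia.
    apply Req_le. unfold dist2, tail. ring.
- apply is_lim_seq_const.
- replace (Finite 0) with (Finite (2 * 0 + 2 * (0 * 0 + 0 * 0))) by (f_equal; ring).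
  apply is_lim_seq_plus'.
  + apply (is_lim_seq_scal_l _ 2 (Finite 0)). now apply dot_trunc_tail.
  + apply (is_lim_seq_scal_l _ 2 (Finite (0 * 0 + 0 * 0))).
    apply is_lim_seq_plus'; now apply is_lim_seq_mult'.
Qed.

Lemma jacobi_sum (d b : nat -> R) (A : nat -> nat -> R) (f u : nat -> R) (X n : nat) :
  eigen d b A f ->
  jacobi d b (app (tr A) (trunc X u)) n = app (tr A) (trunc X (fun x => f x * u x)) n.
Proof.
intros HE. rewrite app_trunc.
rewrite (jacobi_ext _ _ _ _ _ (app_trunc (tr A) X u)).
induction X as [|X IH].
- rewrite sum_O. transitivity (u O * jacobi d b (tr A O) n).
  + unfold jacobi. destruct n; rewrite !sum_O; ring.
  + rewrite HE. unfold tr. ring.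
- rewrite sum_Sn, <- IH.
  transitivity (jacobi d b (fun n => sum_n (fun x => u x * tr A x n) X) n
                + u (S X) * jacobi d b (tr A (S X)) n).
  + unfold jacobi. destruct n; rewrite !sum_Sn; unfold plus; simpl; ring.
  + rewrite HE. unfold tr, plus; simpl. ring.
Qed.

Lemma is_lim_seq_sum (a : nat -> nat -> R) (u : nat -> R) (X : nat) :
  (forall x, is_lim_seq (fun n => a n x) 0) ->
  is_lim_seq (fun n => sum_n (fun x => u x * a n x) X) 0.
Proof.
intros Ha.
assert (Hx : forall x, is_lim_seq (fun n => u x * a n x) 0).
{ intros x. replace 0 with (u x * 0) by ring. exact (is_lim_seq_scal_l _ (u x) (Finite 0) (Ha x)). }
induction X as [|X IH].
- eapply is_lim_seq_ext; [|apply (Hx O)]. intros n. now rewrite sum_O.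
- replace 0 with (0 + 0) by ring.
  eapply is_lim_seq_ext; [|exact (is_lim_seq_plus' _ _ _ _ IH (Hx (S X)))].
  intros n. now rewrite sum_Sn.
Qed.

Lemma is_lim_seq_lt (u : nat -> R) (e : R) : is_lim_seq u 0 -> 0 < e ->
  eventually (fun n => u n < e).
Proof.
intros Hu He. apply (Hu (fun y => y < e)).
exists (mkposreal e He). intros y Hy.
apply (Rabs_def2 _ _) in Hy. unfold minus, plus, opp in Hy; simpl in Hy. lra.
Qed.

(* Finitely supported vectors form a core: cut [u] off at a large [X], which
   leaves a finite combination of eigenvectors, then cut that off in [n]; the
   second step costs only the two boundary terms of [jacobi_trunc_lim]. *)
Lemma finsupp_core (d b : nat -> R) (A : nat -> nat -> R) (f u : nat -> R) (eps : R) :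
  orthonormal A -> orthonormal (tr A) -> eigen d b A f ->
  (forall x, is_lim_seq (fun n => b n * A n x) 0) ->
  (forall x, is_lim_seq (fun n => b n * A (S n) x) 0) ->
  l2 u -> l2 (fun x => f x * u x) -> 0 < eps ->
  exists v, finsupp v /\ dist2 v (app (tr A) u) < eps /\
    dist2 (jacobi d b v) (app (tr A) (fun x => f x * u x)) < eps.
Proof.
intros HA HB HE L1 L2 Hu Hfu Heps.
set (fu := fun x => f x * u x) in *.
(* There are two approximation errors, and [dist2_triangle] doubles each. *)
assert (He : 0 < eps / 4) by lra.
destruct (filter_and _ _ (is_lim_seq_lt _ _ (dot_trunc_tail u Hu) He)
            (is_lim_seq_lt _ _ (dot_trunc_tail fu Hfu) He)) as [X HX].
destruct (HX X (le_n X)) as [X1 X2]. clear HX.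
set (z := app (tr A) (trunc X u)).
assert (Hc : forall w, l2 w -> l2 (app (tr A) w))
  by (intros w Hw; now apply (app_contraction (tr A))).
assert (Hz : l2 z) by (apply Hc, l2_trunc).
assert (Ez : forall n, app (tr A) (trunc X fu) n = jacobi d b z n)
  by (intros n; symmetry; now apply jacobi_sum).
assert (Hjz : l2 (jacobi d b z)) by (apply l2_ext with (1 := Ez); apply Hc, l2_trunc).
assert (M1 : is_lim_seq (fun n => b n * z n) 0).
{ eapply is_lim_seq_ext; [|apply (is_lim_seq_sum _ u X L1)].
  intros n. unfold z. rewrite app_trunc.
  rewrite <- (sum_n_mult_l (b n)). apply sum_n_ext. intros x. unfold mult; simpl.
  unfold tr. ring. }
assert (M2 : is_lim_seq (fun n => b n * z (S n)) 0).
{ eapply is_lim_seq_ext; [|apply (is_lim_seq_sum _ u X L2)].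
  intros n. unfold z. rewrite app_trunc.
  rewrite <- (sum_n_mult_l (b n)). apply sum_n_ext. intros x. unfold mult; simpl.
  unfold tr. ring. }
destruct (filter_and _ _ (is_lim_seq_lt _ _ (dot_trunc_tail z Hz) He)
            (is_lim_seq_lt _ _ (jacobi_trunc_lim d b z Hjz M1 M2) He)) as [N HN].
destruct (HN N (le_n N)) as [N1 N2]. clear HN.
exists (trunc N z). assert (Hf := finsupp_trunc N z). split; [exact Hf|]. split.
- eapply Rle_lt_trans; [apply (dist2_triangle _ z); auto; apply l2_trunc|].
  unfold z at 3. rewrite (dist2_app (tr A)) by (auto; apply l2_trunc).
  rewrite (dist2_sym (trunc N z)), (dist2_sym (trunc X u)). lra.
- eapply Rle_lt_trans; [apply (dist2_triangle _ (jacobi d b z)); auto|].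
  { now apply finsupp_l2, finsupp_jacobi. }
  rewrite <- (dist2_ext _ _ _ _ Ez (fun n => eq_refl (app (tr A) fu n))).
  rewrite (dist2_app (tr A)) by (auto; apply l2_trunc).
  rewrite (dist2_sym (trunc X fu)). lra.
Qed.

(** * The Charlier matrix *)

Definition charlier_matrix (sg a : R) (n x : nat) : R :=
  sg ^ n * charlier n x a * sqrt (charlier_weight a x).

(** The same root normalises the polynomial in n and, up to the factor sqrt(exp(-a)), is the root of
    the weight in x. Hence the matrix is symmetric apart from sg^n. *)
Definition charlier_scale (a : R) (n : nat) : R := sqrt (a ^ n / INR (fact n)).

Lemma charlier_scale_sqr (a : R) (n : nat) : 0 < a ->
  charlier_scale a n * charlier_scale a n = a ^ n / INR (fact n).
Proof.
intros Ha. apply sqrt_sqrt. apply Rlt_le, Rdiv_lt_0_compat; [now apply pow_lt|].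
apply INR_fact_lt_0.
Qed.

Lemma charlier_scale_succ (a : R) (n : nat) : 0 < a ->
  sqrt (INR (S n)) * charlier_scale a (S n) = sqrt a * charlier_scale a n.
Proof.
intros Ha. unfold charlier_scale.
assert (0 < INR (fact n)) by apply INR_fact_lt_0.
assert (0 < INR (S n)) by (apply lt_0_INR; lia).
assert (0 < a ^ n) by now apply pow_lt.
rewrite <- !sqrt_mult_alt by lra. f_equal.
change (fact (S n)) with (S n * fact n)%nat. rewrite mult_INR. simpl pow.
field. split; lra.
Qed.

Lemma charlier_weight_pos (a : R) (x : nat) : 0 < a -> 0 < charlier_weight a x.
Proof.
intros Ha. apply Rmult_lt_0_compat; [|apply exp_pos].
apply Rdiv_lt_0_compat; [now apply pow_lt|apply INR_fact_lt_0].
Qed.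

Lemma charlier_matrix_eq (sg a : R) (n x : nat) : 0 < a ->
  charlier_matrix sg a n x
  = sg ^ n * sqrt (exp (- a)) * charlier_scale a n * charlier_scale a x * cpoly a n x.
Proof.
intros Ha. unfold charlier_matrix, charlier_weight.
change (charlier n x a) with (charlier_scale a n * cpoly a n x).
rewrite sqrt_mult_alt.
- fold (charlier_scale a x). ring.
- apply Rlt_le, Rdiv_lt_0_compat; [now apply pow_lt|apply INR_fact_lt_0].
Qed.

Lemma charlier_matrix_orthonormal (sg a : R) : 0 < a -> sg * sg = 1 ->
  orthonormal (charlier_matrix sg a).
Proof.
intros Ha Hs n m.
set (k := sg ^ n * sg ^ m * charlier_scale a n * charlier_scale a m * exp (- a)).
assert (He : sqrt (exp (- a)) * sqrt (exp (- a)) = exp (- a))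
  by (apply sqrt_sqrt, Rlt_le, exp_pos).
apply is_series_eq with
  (fun x => k * (cpoly a n x * cpoly a m x * (a ^ x / INR (fact x)))).
- intros x. unfold k. rewrite <- He, !charlier_matrix_eq, <- charlier_scale_sqr by exact Ha.
  ring.
- assert (E : k * moment a n m = if Nat.eqb n m then 1 else 0).
  { rewrite moment_value by exact Ha. destruct (Nat.eqb_spec n m) as [<-|]; [|ring].
    unfold k. rewrite <- Rpow_mult_distr, Hs, pow1.
    replace (1 * charlier_scale a n * charlier_scale a n)
      with (charlier_scale a n * charlier_scale a n) by ring.
    rewrite charlier_scale_sqr by exact Ha.
    rewrite exp_Ropp. pose proof (exp_pos a). pose proof (INR_fact_neq_0 n).
    field. repeat split; auto; try lra. apply pow_nonzero. lra. }
  assert (Hk : is_series (fun x => k * (cpoly a n x * cpoly a m x * (a ^ x / INR (fact x))))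
                 (k * moment a n m))
    by exact (is_series_scal k _ _ (Series_correct _ (ex_moment a n m Ha))).
  rewrite E in Hk. exact Hk.
Qed.

Lemma charlier_matrix_tr_orthonormal (sg a : R) : 0 < a -> sg * sg = 1 ->
  orthonormal (tr (charlier_matrix sg a)).
Proof.
intros Ha Hs x y.
(* The rows are taken with sign 1: in a sum over n the factor sg^n occurs squared. *)
eapply is_series_eq; [|exact (charlier_matrix_orthonormal 1 a Ha (Rmult_1_l 1) x y)].
intros n. unfold tr. rewrite !charlier_matrix_eq by exact Ha.
rewrite (cpoly_sym a n x), (cpoly_sym a n y), !pow1.
assert (E : sg ^ n * sg ^ n = 1) by (rewrite <- Rpow_mult_distr, Hs; apply pow1).
set (q := sqrt (exp (- a)) * charlier_scale a x * charlier_scale a n * cpoly a x n).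
set (q' := sqrt (exp (- a)) * charlier_scale a y * charlier_scale a n * cpoly a y n).
transitivity (q * q'); [unfold q, q'; ring|].
transitivity ((sg ^ n * sg ^ n) * (q * q')); [rewrite E; ring|unfold q, q'; ring].
Qed.

(** This is [cpoly_rec] after normalisation: [Q1] and [Q2] trade the root sqrt(a(n+1)) for a shift
    of the scale, and -sg times either neighbouring power of sg is -sg^n. *)
Lemma charlier_matrix_jacobi (sg a : R) (n x : nat) : 0 < a -> sg * sg = 1 ->
  jacobi (fun n => INR n + a) (fun n => - sg * sqrt (a * INR (S n)))
    (tr (charlier_matrix sg a) x) n
  = INR x * charlier_matrix sg a n x.
Proof.
intros Ha Hs.
assert (Sa : sqrt a * sqrt a = a) by (apply sqrt_sqrt; lra).
assert (Q1 : forall m, sqrt (a * INR (S m)) * charlier_scale a (S m) = a * charlier_scale a m).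
{ intros m. rewrite sqrt_mult_alt, Rmult_assoc, charlier_scale_succ by lra.
  rewrite <- Rmult_assoc, Sa. ring. }
assert (Q2 : forall m, sqrt (a * INR (S m)) * charlier_scale a m
                       = INR (S m) * charlier_scale a (S m)).
{ intros m. rewrite sqrt_mult_alt by lra.
  replace (sqrt a * sqrt (INR (S m)) * charlier_scale a m)
    with (sqrt (INR (S m)) * (sqrt a * charlier_scale a m)) by ring.
  rewrite <- charlier_scale_succ, <- Rmult_assoc, sqrt_sqrt by (auto; apply pos_INR).
  reflexivity. }
set (e := sqrt (exp (- a)) * charlier_scale a x).
assert (HM : forall m, charlier_matrix sg a m x
               = sg ^ m * charlier_scale a m * cpoly a m x * e).
{ intros m. rewrite charlier_matrix_eq by exact Ha. unfold e. ring. }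
assert (HR := cpoly_rec a n x ltac:(lra)).
transitivity (sg ^ n * charlier_scale a n * e * (INR x * cpoly a n x)).
2:{ rewrite HM. ring. }
rewrite HR. unfold jacobi, tr. rewrite !HM.
replace (- sg * sqrt (a * INR (S n)) *
  (sg ^ S n * charlier_scale a (S n) * cpoly a (S n) x * e))
  with (- (sg * sg) * sg ^ n * (sqrt (a * INR (S n)) * charlier_scale a (S n))
         * cpoly a (S n) x * e) by (simpl; ring).
rewrite Q1, Hs.
destruct n as [|n].
- simpl. ring.
- rewrite HM.
  replace (- sg * sqrt (a * INR (S n)) * (sg ^ n * charlier_scale a n * cpoly a n x * e))
    with (- sg ^ S n * (sqrt (a * INR (S n)) * charlier_scale a n) * cpoly a n x * e)
    by (simpl; ring).
  rewrite Q2. simpl pred. ring.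
Qed.

(* The three-term recurrence in [x] expresses [n A(n,x)] through square summable columns. *)
Lemma charlier_matrix_index_lim (sg a : R) (x : nat) : 0 < a -> sg * sg = 1 ->
  is_lim_seq (fun n => INR n * charlier_matrix sg a n x) 0.
Proof.
intros Ha Hs.
(* The columns are stripped of their x-dependent scale, so that those at x + 1, x and x - 1 can be
   combined directly. *)
set (P := fun n y => sg ^ n * charlier_scale a n * cpoly a n y).
assert (HP : forall y, is_lim_seq (fun n => P n y) 0).
{ intros y.
  assert (Hk : sqrt (exp (- a)) * charlier_scale a y <> 0).
  { apply Rgt_not_eq, Rmult_lt_0_compat; apply sqrt_lt_R0; [apply exp_pos|].
    apply Rdiv_lt_0_compat; [now apply pow_lt|apply INR_fact_lt_0]. }
  assert (HL := l2_lim0 _ (orthonormal_l2 _ y (charlier_matrix_tr_orthonormal sg a Ha Hs))).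
  replace 0 with (/ (sqrt (exp (- a)) * charlier_scale a y) * 0) by ring.
  eapply is_lim_seq_ext;
    [|exact (is_lim_seq_scal_l _ (/ (sqrt (exp (- a)) * charlier_scale a y)) (Finite 0) HL)].
  intros n. unfold tr. rewrite charlier_matrix_eq by exact Ha. unfold P. field.
  split; intros E; apply Hk; rewrite E; ring. }
set (k := sqrt (exp (- a)) * charlier_scale a x).
assert (HS : forall c y, is_lim_seq (fun n => c * P n y) 0).
{ intros c y. replace 0 with (c * 0) by ring. exact (is_lim_seq_scal_l _ c (Finite 0) (HP y)). }
replace 0 with (k * (- a) * 0 + k * (INR x + a) * 0 + k * (- INR x) * 0) by ring.
eapply is_lim_seq_ext; [|exact (is_lim_seq_plus' _ _ _ _ (is_lim_seq_plus' _ _ _ _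
   (is_lim_seq_scal_l _ (k * (- a)) (Finite 0) (HP (S x)))
   (is_lim_seq_scal_l _ (k * (INR x + a)) (Finite 0) (HP x)))
   (is_lim_seq_scal_l _ (k * (- INR x)) (Finite 0) (HP (pred x))))].
intros n. rewrite charlier_matrix_eq by exact Ha.
transitivity (k * sg ^ n * charlier_scale a n * (INR n * cpoly a x n)).
- rewrite cpoly_rec by lra. unfold P. rewrite (cpoly_sym a n (S x)), (cpoly_sym a n x),
    (cpoly_sym a n (pred x)). ring.
- rewrite (cpoly_sym a n x). unfold k. ring.
Qed.

Lemma is_lim_seq_bound (u w : nat -> R) :
  (forall n, Rabs (u n) <= Rabs (w n)) -> is_lim_seq w 0 -> is_lim_seq u 0.
Proof.
intros Hu Hw. apply is_lim_seq_abs_0.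
apply (is_lim_seq_le_le (fun _ => 0) _ (fun n => Rabs (w n))).
- intros n. split; [apply Rabs_pos|apply Hu].
- apply is_lim_seq_const.
- now apply (is_lim_seq_abs_0 w).
Qed.

(** The off-diagonal entries grow like sqrt(n), so a multiple of n + 1 dominates them. *)
Lemma charlier_matrix_offdiag_lim (sg a h r : R) (x : nat) : 0 < a -> sg * sg = 1 ->
  is_lim_seq (fun n => r * sqrt (h * INR (S n)) * charlier_matrix sg a n x) 0 /\
  is_lim_seq (fun n => r * sqrt (h * INR (S n)) * charlier_matrix sg a (S n) x) 0.
Proof.
intros Ha Hs.
assert (Hb : forall n, Rabs (r * sqrt (h * INR (S n))) <= Rabs (r * sqrt (Rabs h) * INR (S n))).
{ intros n. rewrite !Rabs_mult, Rmult_assoc. apply Rmult_le_compat_l; [apply Rabs_pos|].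
  assert (1 <= INR (S n)) by (rewrite S_INR; pose proof (pos_INR n); lra).
  rewrite !Rabs_pos_eq by (try apply sqrt_pos; lra).
  apply Rle_trans with (sqrt (Rabs h * (INR (S n) * INR (S n)))).
  - apply sqrt_le_1_alt. pose proof (Rle_abs h). pose proof (Rabs_pos h).
    apply Rle_trans with (Rabs h * INR (S n)); [apply Rmult_le_compat_r; lra|].
    apply Rmult_le_compat_l; nra.
  - rewrite sqrt_mult_alt by apply Rabs_pos. rewrite sqrt_square by apply pos_INR.
    rewrite (Rabs_pos_eq (INR (S n))) by apply pos_INR. lra. }
assert (Li := charlier_matrix_index_lim sg a x Ha Hs).
assert (L0 : is_lim_seq (fun n => charlier_matrix sg a n x) 0)
  by exact (l2_lim0 _ (orthonormal_l2 _ x (charlier_matrix_tr_orthonormal sg a Ha Hs))).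
assert (L1 : is_lim_seq (fun n => INR (S n) * charlier_matrix sg a n x) 0).
{ replace 0 with (0 + 0) by ring.
  eapply is_lim_seq_ext; [|exact (is_lim_seq_plus' _ _ _ _ Li L0)].
  intros n. rewrite S_INR. simpl. ring. }
assert (L2 := proj1 (is_lim_seq_incr_1 _ _) Li).
split.
- apply is_lim_seq_bound with (fun n => r * sqrt (Rabs h) * (INR (S n) * charlier_matrix sg a n x)).
  + intros n. rewrite <- Rmult_assoc, (Rabs_mult _ (charlier_matrix sg a n x)),
      (Rabs_mult (_ * _ * _) (charlier_matrix sg a n x)).
    apply Rmult_le_compat_r; [apply Rabs_pos|apply Hb].
  + replace 0 with (r * sqrt (Rabs h) * 0) by ring. now apply (is_lim_seq_scal_l _ _ (Finite 0)).
- apply is_lim_seq_bound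
    with (fun n => r * sqrt (Rabs h) * (INR (S n) * charlier_matrix sg a (S n) x)).
  + intros n. rewrite <- Rmult_assoc, (Rabs_mult _ (charlier_matrix sg a (S n) x)),
      (Rabs_mult (_ * _ * _) (charlier_matrix sg a (S n) x)).
    apply Rmult_le_compat_r; [apply Rabs_pos|apply Hb].
  + replace 0 with (r * sqrt (Rabs h) * 0) by ring. now apply (is_lim_seq_scal_l _ _ (Finite 0)).
Qed.

(** * The conserved quantity *)

Lemma is_derive_halfline_pos (f : R -> R) (t l : R) : 0 < t ->
  is_derive_halfline f t l -> is_derive f t l.
Proof.
intros Ht Hf. apply is_derive_Reals. intros eps Heps.
assert (HB : locally l (fun z => Rabs (z - l) < eps)).
{ exists (mkposreal eps Heps). intros z Hz. exact Hz. }
destruct (Hf _ HB) as [delta Hd].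
(* An increment smaller than [t] stays inside the half-line. *)
assert (Hm : 0 < Rmin delta t) by (apply Rmin_pos; [apply cond_pos|exact Ht]).
exists (mkposreal _ Hm). intros y Hy Hyd. simpl in Hyd.
assert (Rmin delta t <= delta) by apply Rmin_l.
assert (Rmin delta t <= t) by apply Rmin_r.
apply Rabs_def2 in Hyd as Hyd'.
replace ((f (t + y) - f t) / y) with ((f (t + y) - f t) / (t + y - t)).
- apply Hd.
  + change (Rabs (t + y - t) < delta). replace (t + y - t) with y by ring. lra.
  + split; [lra|]. intros E. apply Hy. lra.
- f_equal. ring.
Qed.

(** One-sided continuity at 0 along a single sequence, enough to carry a constant value to the
    endpoint. *)
Lemma is_derive_halfline_0_lim (f : R -> R) (l : R) :
  is_derive_halfline f 0 l -> is_lim_seq (fun n => f (/ INR (S n))) (f 0).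
Proof.
intros Hf.
assert (Hp : forall n, 0 < / INR (S n)) by (intros n; apply Rinv_0_lt_compat, lt_0_INR; lia).
assert (Hq : is_lim_seq (fun n => (f (/ INR (S n)) - f 0) / (/ INR (S n) - 0)) l).
{ apply (filterlim_comp _ _ _ (fun n => / INR (S n)) (fun y => (f y - f 0) / (y - 0)) _ _ _)
    with (2 := Hf).
  intros P HP. unfold within in HP.
  assert (H := is_lim_seq_inv_S _ HP). unfold filtermap in *.
  revert H. apply filter_imp. intros n Hn. apply Hn. specialize (Hp n). lra. }
replace (f 0) with (f 0 + l * 0) by ring.
eapply is_lim_seq_ext;
  [|exact (is_lim_seq_plus' _ _ _ _ (is_lim_seq_const (f 0))
             (is_lim_seq_mult' _ _ _ _ Hq is_lim_seq_inv_S))].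
intros n. specialize (Hp n). cbv beta. set (y := / INR (S n)) in *. field. lra.
Qed.

(** The derivative is r r'/c + s' = -2 r u + 2 r u = 0. The reference time 1 is interior, where
    derivatives are two-sided; the endpoint 0 follows by a limit. *)
Lemma conserved_quantity (c : R) (r s u : R -> R) : c <> 0 ->
  (forall t, 0 <= t -> is_derive_halfline s t (2 * r t * u t)) ->
  (forall t, 0 <= t -> is_derive_halfline r t (- 2 * c * u t)) ->
  forall t, 0 <= t -> 1 / (2 * c) * r t ^ 2 + s t = 1 / (2 * c) * r 1 ^ 2 + s 1.
Proof.
intros Hc Hs Hr.
set (g := fun t => 1 / (2 * c) * r t ^ 2 + s t).
assert (Hg : forall t, 0 < t -> is_derive g t 0).
{ intros t Ht.
  assert (Ds := is_derive_halfline_pos s t _ Ht (Hs t (Rlt_le _ _ Ht))).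
  assert (Dr := is_derive_halfline_pos r t _ Ht (Hr t (Rlt_le _ _ Ht))).
  unfold g. auto_derive.
  - repeat split; eexists; eassumption.
  - change (fun x => r x) with r. change (fun x => s x) with s.
    rewrite (is_derive_unique r _ _ Dr), (is_derive_unique s _ _ Ds).
    field. exact Hc. }
assert (Hpos : forall t, 0 < t -> g t = g 1).
{ intros t Ht.
  assert (Hm : 0 < Rmin 1 t) by (apply Rmin_pos; lra).
  destruct (MVT_gen g 1 t (fun _ => 0)) as [y [_ Hy]].
  - intros x Hx. apply Hg. lra.
  - intros x Hx. apply continuity_pt_filterlim.
    apply (ex_derive_continuous g). exists 0. apply Hg. lra.
  - lra. }
intros t [Ht|<-]; [now apply Hpos|].
assert (Hl : is_lim_seq (fun n => g (/ INR (S n))) (g 0)).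
{ assert (Lr := is_derive_halfline_0_lim r _ (Hr 0 (Rle_refl 0))).
  assert (Ls := is_derive_halfline_0_lim s _ (Hs 0 (Rle_refl 0))).
  unfold g. apply is_lim_seq_plus'; [|exact Ls].
  apply (is_lim_seq_scal_l _ _ (Finite (r 0 ^ 2))).
  replace (r 0 ^ 2) with (r 0 * r 0) by ring.
  eapply is_lim_seq_ext; [|exact (is_lim_seq_mult' _ _ _ _ Lr Lr)].
  intros n. simpl. ring. }
assert (Hl' : is_lim_seq (fun n => g (/ INR (S n))) (g 1)).
{ apply is_lim_seq_ext with (fun _ => g 1); [|apply is_lim_seq_const].
  intros n. symmetry. apply Hpos, Rinv_0_lt_compat, lt_0_INR. lia. }
change (g 0 = g 1).
apply is_lim_seq_unique in Hl. apply is_lim_seq_unique in Hl'. congruence.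
Qed.

(** * Real and imaginary parts *)

(** With [S] the root of the weight, [wre] and [wim] carry L^2(N, W) isometrically to pairs of real
    l^2 sequences. *)
Definition wre (S : nat -> R) (f : nat -> C) (x : nat) : R := S x * Re (f x).
Definition wim (S : nat -> R) (f : nat -> C) (x : nat) : R := S x * Im (f x).

Definition root_of (W S : nat -> R) : Prop := forall x, 0 < S x /\ W x = S x * S x.

Lemma Cmod_sqr (z : C) : Cmod z ^ 2 = Re z ^ 2 + Im z ^ 2.
Proof.
unfold Cmod. rewrite pow2_sqrt; [reflexivity|].
pose proof (pow2_ge_0 (fst z)). pose proof (pow2_ge_0 (snd z)). lra.
Qed.

Lemma in_L2_iff (W S : nat -> R) (f : nat -> C) : root_of W S ->
  in_L2 W f <-> l2 (wre S f) /\ l2 (wim S f).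
Proof.
intros HW.
assert (E : forall x, Cmod (f x) ^ 2 * W x = wre S f x ^ 2 + wim S f x ^ 2).
{ intros x. rewrite Cmod_sqr, (proj2 (HW x)). unfold wre, wim. ring. }
split.
- intros Hf. split; (apply ex_series_bound with (2 := Hf); intros x; rewrite E;
    rewrite Rabs_pos_eq by apply pow2_ge_0).
  + pose proof (pow2_ge_0 (wim S f x)). lra.
  + pose proof (pow2_ge_0 (wre S f x)). lra.
- intros [H1 H2]. unfold in_L2.
  apply (ex_series_ext (fun x => wre S f x ^ 2 + wim S f x ^ 2)).
  + intros x. now rewrite E.
  + exact (ex_series_plus _ _ H1 H2).
Qed.

Lemma in_L2_ext (W : nat -> R) (f g : nat -> C) :
  (forall x, f x = g x) -> in_L2 W f -> in_L2 W g.
Proof. intros E. apply ex_series_ext. intros x. now rewrite E. Qed.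

Lemma ip_eq (W S : nat -> R) (f g : nat -> C) : root_of W S -> in_L2 W f -> in_L2 W g ->
  ip W f g = (dot (wre S f) (wre S g) + dot (wim S f) (wim S g),
              dot (wim S f) (wre S g) - dot (wre S f) (wim S g)).
Proof.
intros HW Hf Hg.
apply (in_L2_iff W S) in Hf as [F1 F2]; [|exact HW].
apply (in_L2_iff W S) in Hg as [G1 G2]; [|exact HW].
unfold ip, Cseries, dot. rewrite <- Series_plus, <- Series_minus by now apply l2_dot.
f_equal; apply Series_ext; intros x; rewrite (proj2 (HW x)); unfold wre, wim, Re, Im; simpl;
  ring.
Qed.

Lemma root_of_unit : root_of unit_weight (fun _ => 1).
Proof. intros x. unfold unit_weight. lra. Qed.

Definition re (f : nat -> C) (n : nat) : R := Re (f n).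
Definition im (f : nat -> C) (n : nat) : R := Im (f n).

Lemma in_l2_iff (f : nat -> C) : in_L2 unit_weight f <-> l2 (re f) /\ l2 (im f).
Proof.
rewrite (in_L2_iff _ _ f root_of_unit).
assert (E1 : forall n, wre (fun _ => 1) f n = re f n) by (intros n; apply Rmult_1_l).
assert (E2 : forall n, wim (fun _ => 1) f n = im f n) by (intros n; apply Rmult_1_l).
split; intros [H1 H2]; split.
- exact (l2_ext _ _ E1 H1).
- exact (l2_ext _ _ E2 H2).
- exact (l2_ext _ _ (fun n => eq_sym (E1 n)) H1).
- exact (l2_ext _ _ (fun n => eq_sym (E2 n)) H2).
Qed.

Lemma ip_unit_eq (f g : nat -> C) : in_L2 unit_weight f -> in_L2 unit_weight g ->
  ip unit_weight f g = (dot (re f) (re g) + dot (im f) (im g),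
                        dot (im f) (re g) - dot (re f) (im g)).
Proof.
intros Hf Hg. rewrite (ip_eq _ _ f g root_of_unit Hf Hg).
apply (f_equal2 pair); [apply (f_equal2 Rplus)|apply (f_equal2 Rminus)];
  apply dot_ext; intros n; unfold wre, wim, re, im; ring.
Qed.

Lemma L2norm_dist2 (f g : nat -> C) : in_L2 unit_weight f -> in_L2 unit_weight g ->
  L2norm unit_weight (fsub f g) = sqrt (dist2 (re f) (re g) + dist2 (im f) (im g)).
Proof.
intros Hf Hg. apply in_l2_iff in Hf as [F1 F2]. apply in_l2_iff in Hg as [G1 G2].
unfold L2norm, dist2, dot. f_equal.
rewrite <- Series_plus by now apply l2_sqr, l2_minus.
apply Series_ext. intros x. rewrite Cmod_sqr. unfold fsub, unit_weight, re, im, Re, Im. simpl. ring.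
Qed.

(** * The operator [U] *)

Definition charlier_sign (c r : R) : R := - sign (r / c).

Definition charlier_mx (h c r : R) : nat -> nat -> R :=
  charlier_matrix (charlier_sign c r) (charlier_param h c r).

Definition weight_root (h c r : R) (x : nat) : R := sqrt (weight h c r x).

(** The entries of [U_basis] are real, so both parts are transformed by the same real matrix.
    Constant factors pass through [Series] unconditionally. *)
Lemma U_op_parts (h c r : R) (v : nat -> C) (x : nat) :
  wre (weight_root h c r) (U_op h c r v) x = app (charlier_mx h c r) (re v) x /\
  wim (weight_root h c r) (U_op h c r v) x = app (charlier_mx h c r) (im v) x.
Proof.
unfold wre, wim, U_op, Cseries, app, dot, Re, Im. cbn [fst snd].
rewrite <- !Series_scal_l.
split; apply Series_ext; intros n; unfold tr, charlier_mx, charlier_matrix, U_basis,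
  charlier_sign, weight_root, weight, re, im, Re, Im; simpl; ring.
Qed.

Definition U_inv (h c r : R) (g : nat -> C) (n : nat) : C :=
  (app (tr (charlier_mx h c r)) (wre (weight_root h c r) g) n,
   app (tr (charlier_mx h c r)) (wim (weight_root h c r) g) n).

Lemma weighted_ext (S : nat -> R) (f g : nat -> C) (x : nat) : 0 < S x ->
  wre S f x = wre S g x -> wim S f x = wim S g x -> f x = g x.
Proof.
unfold wre, wim. intros HS H1 H2.
apply Rmult_eq_reg_l in H1; [|lra]. apply Rmult_eq_reg_l in H2; [|lra].
rewrite (surjective_pairing (f x)), (surjective_pairing (g x)). now f_equal.
Qed.

(** * Unitarity and adjoint at a fixed time *)

Section Fixed_time.

Variables (h c r : R).
Hypotheses (Hh : 0 < h) (Hc : c <> 0) (Hr : r <> 0).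

Let A := charlier_mx h c r.
Let W := weight h c r.
Let S0 := weight_root h c r.
Let U := U_op h c r.
Let V := U_inv h c r.

Lemma charlier_param_pos : 0 < charlier_param h c r.
Proof.
assert (0 < r ^ 2) by now apply pow2_gt_0.
assert (0 < c ^ 2) by now apply pow2_gt_0.
unfold charlier_param. apply Rdiv_lt_0_compat; nra.
Qed.

Lemma ratio_neq_0 : r / c <> 0.
Proof.
apply Rmult_integral_contrapositive_currified; [exact Hr|now apply Rinv_neq_0_compat].
Qed.

(** The reason for the sign in [U_basis]: the root of the Charlier parameter sees only |r/c|, and
    this factor restores the sign. *)
Lemma charlier_sign_abs (y : R) : - charlier_sign c r * Rabs (r / c * y) = r / c * Rabs y.
Proof.
unfold charlier_sign. rewrite Rabs_mult.
assert (Hq := ratio_neq_0).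
destruct (Rtotal_order (r / c) 0) as [L|[L|L]]; [|easy|].
- rewrite sign_eq_m1, Rabs_left by exact L. ring.
- rewrite sign_eq_1, Rabs_pos_eq by lra. ring.
Qed.

Lemma charlier_sign_sqr : charlier_sign c r * charlier_sign c r = 1.
Proof.
unfold charlier_sign.
assert (Hq := ratio_neq_0).
destruct (Rtotal_order (r / c) 0) as [L|[L|L]]; [|easy|].
- rewrite sign_eq_m1 by exact L. ring.
- rewrite sign_eq_1 by exact L. ring.
Qed.

Lemma mx_orth : orthonormal A.
Proof. exact (charlier_matrix_orthonormal _ _ charlier_param_pos charlier_sign_sqr). Qed.

Lemma mx_tr_orth : orthonormal (tr A).
Proof. exact (charlier_matrix_tr_orthonormal _ _ charlier_param_pos charlier_sign_sqr). Qed.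

Lemma weight_root_of : root_of W S0.
Proof.
intros x.
assert (HW : 0 < W x) by (apply charlier_weight_pos, charlier_param_pos).
split; [now apply sqrt_lt_R0|]. symmetry. apply sqrt_sqrt. lra.
Qed.

Lemma S0_pos (x : nat) : 0 < S0 x.
Proof. apply weight_root_of. Qed.

Lemma U_parts (v : nat -> C) (x : nat) :
  wre S0 (U v) x = app A (re v) x /\ wim S0 (U v) x = app A (im v) x.
Proof. exact (U_op_parts h c r v x). Qed.

Lemma U_op_maps : maps_L2 unit_weight W U.
Proof.
intros v Hv. apply in_l2_iff in Hv as [H1 H2].
apply (in_L2_iff W S0 _ weight_root_of).
destruct (app_contraction A _ mx_orth mx_tr_orth H1) as [P1 _].
destruct (app_contraction A _ mx_orth mx_tr_orth H2) as [P2 _].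
split; [apply l2_ext with (2 := P1)|apply l2_ext with (2 := P2)];
  intros x; symmetry; apply U_op_parts.
Qed.

Lemma U_inv_maps : maps_L2 W unit_weight V.
Proof.
intros g Hg. apply (in_L2_iff W S0 _ weight_root_of) in Hg as [H1 H2].
apply in_l2_iff. split.
- now apply (app_contraction (tr A) _ mx_tr_orth mx_orth).
- now apply (app_contraction (tr A) _ mx_tr_orth mx_orth).
Qed.

Lemma U_op_U_inv (g : nat -> C) (x : nat) : in_L2 W g -> U (V g) x = g x.
Proof.
intros Hg. apply (in_L2_iff W S0 _ weight_root_of) in Hg as [H1 H2].
apply weighted_ext with S0; [apply S0_pos| |].
- rewrite (proj1 (U_parts (V g) x)).
  exact (app_tr_app (tr A) _ x mx_tr_orth mx_orth H1).
- rewrite (proj2 (U_parts (V g) x)).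
  exact (app_tr_app (tr A) _ x mx_tr_orth mx_orth H2).
Qed.

Lemma U_op_dot (u v : nat -> R) (P Q : nat -> R) : l2 u -> l2 v ->
  (forall x, P x = app A u x) -> (forall x, Q x = app A v x) -> dot P Q = dot u v.
Proof.
intros Hu Hv EP EQ. rewrite (dot_ext _ _ _ _ EP EQ).
exact (app_dot A u v mx_orth mx_tr_orth Hu Hv).
Qed.

Lemma U_op_unitary : is_unitary unit_weight W U.
Proof.
assert (E := U_parts).
split; [exact U_op_maps|]. split; [|split].
- intros a v w Hv Hw x.
  apply in_l2_iff in Hv as [V1 V2]. apply in_l2_iff in Hw as [W1 W2].
  (* Either part of a v + w is a real combination of three sequences: both parts of [v] and one of
     [w]. *)
  assert (Hl : forall p q u1 u2 u3, l2 u1 -> l2 u2 -> l2 u3 ->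
    app A (fun n => p * u1 n + q * u2 n + u3 n) x
    = p * app A u1 x + q * app A u2 x + app A u3 x).
  { intros p q u1 u2 u3 h1 h2 h3.
    rewrite (app_ext A _ (fun n => 1 * (p * u1 n + q * u2 n) + 1 * u3 n)) by (intros; ring).
    rewrite !app_lin; auto using mx_tr_orth; [ring|now apply l2_lin]. }
  apply weighted_ext with S0; [apply S0_pos| |].
  + rewrite (proj1 (E _ x)).
    rewrite (app_ext _ _ (fun n => Re a * re v n + - Im a * im v n + re w n)).
    * rewrite Hl by assumption.
      rewrite <- !(proj1 (E _ x)), <- (proj2 (E _ x)).
      unfold wre, wim, fadd, fscal, U, S0, Re, Im. simpl. ring.
    * intros n. unfold re, im, fadd, fscal, Re, Im. simpl. ring.
  + rewrite (proj2 (E _ x)).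
    rewrite (app_ext _ _ (fun n => Re a * im v n + Im a * re v n + im w n)).
    * rewrite Hl by assumption.
      rewrite <- !(proj2 (E _ x)), <- (proj1 (E _ x)).
      unfold wre, wim, fadd, fscal, U, S0, Re, Im. simpl. ring.
    * intros n. unfold re, im, fadd, fscal, Re, Im. simpl. ring.
- intros v w Hv Hw.
  rewrite (ip_eq W S0 _ _ weight_root_of) by now apply U_op_maps.
  rewrite ip_unit_eq by assumption.
  apply in_l2_iff in Hv as [V1 V2]. apply in_l2_iff in Hw as [W1 W2].
  apply (f_equal2 pair); [apply (f_equal2 Rplus)|apply (f_equal2 Rminus)];
    apply U_op_dot; auto; intros x; apply E.
- intros g Hg. exists (V g). split; [now apply U_inv_maps|].
  intros x. now apply U_op_U_inv.
Qed.

(** Write g as U (V g) and use that U preserves inner products. *)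
Lemma U_inv_adjoint : is_adjoint unit_weight W U V.
Proof.
split; [exact U_inv_maps|]. intros v g Hv Hg.
destruct U_op_unitary as (_ & _ & Hip & _).
rewrite <- Hip by (auto; now apply U_inv_maps).
unfold ip, Cseries. f_equal; apply Series_ext; intros x; now rewrite U_op_U_inv.
Qed.

(** * Diagonalisation of the Lax operator *)

Variables (k s C0 : R).
Hypothesis HC0 : C0 = 1 / (2 * c) * r ^ 2 + s.

Let f (x : nat) : R := 2 * c * (INR x + k) - C0 * h.
Let d (n : nat) : R := 2 * c * (k + INR n) - h * s.
Let b (n : nat) : R := r * sqrt (h * INR (S n)).

Lemma pi_lax_parts (v : nat -> C) (n : nat) :
  re (pi_lax k h c r s v) n = jacobi d b (re v) n /\
  im (pi_lax k h c r s v) n = jacobi d b (im v) n.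
Proof.
unfold re, im, jacobi, pi_lax, fadd, fscal, pi_H, pi_N, pi_E, pi_F, d, b, Re, Im.
destruct n as [|n]; cbn [fst snd Cplus Cmult RtoC]; split; ring.
Qed.

Lemma mx_eigen : eigen d b A f.
Proof.
intros x n.
set (a := charlier_param h c r).
(* Here a = h (r/(2c))^2, so the root is sqrt(h(n+1)) |r/(2c)|. *)
assert (Eb : forall n, b n = 2 * c * (- charlier_sign c r * sqrt (a * INR (S n)))).
{ intros m. unfold b, a, charlier_param.
  replace (h * r ^ 2 / (4 * c ^ 2) * INR (S m)) with ((h * INR (S m)) * (r / c * (1 / 2)) ^ 2)
    by (field; exact Hc).
  rewrite (sqrt_mult_alt (h * INR (S m))) by (apply Rmult_le_pos; [lra|apply pos_INR]).
  rewrite <- Rsqr_pow2, sqrt_Rsqr_abs.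
  replace (2 * c * (- charlier_sign c r * (sqrt (h * INR (S m)) * Rabs (r / c * (1 / 2)))))
    with (2 * c * sqrt (h * INR (S m)) * (- charlier_sign c r * Rabs (r / c * (1 / 2)))) by ring.
  rewrite charlier_sign_abs, (Rabs_pos_eq (1 / 2)) by lra. field. exact Hc. }
assert (Ed : forall n, d n = 2 * c * (INR n + a) + (2 * c * k - C0 * h)).
{ intros m. unfold d, a, charlier_param. rewrite HC0. field. exact Hc. }
assert (HJ := charlier_matrix_jacobi _ a n x charlier_param_pos charlier_sign_sqr).
fold a in HJ. change (charlier_matrix (charlier_sign c r) a) with A in HJ.
transitivity (2 * c * (INR x * A n x) + (2 * c * k - C0 * h) * A n x); [|unfold f; ring].
rewrite <- HJ. unfold jacobi. destruct n; rewrite Ed, !Eb; unfold tr; ring.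
Qed.

Lemma U_conj_lax :
  op_eq (op_conj W U (lax_op k h c r s) V) (mult_op W f).
Proof.
assert (HA := mx_orth). assert (HB := mx_tr_orth). assert (HE := mx_eigen).
intros g g'. split.
- intros (Hg & w & (HV & Hw & Hcl) & Eg').
  assert (Hg' : in_L2 W g').
  { apply in_L2_ext with (U w); [intros x; symmetry; apply Eg'|]. now apply U_op_maps. }
  split; [exact Hg|]. split; [exact Hg'|]. intros x. rewrite Eg'.
  assert (HVg := HV). apply in_l2_iff in HVg as [V1 V2].
  assert (Hww := Hw). apply in_l2_iff in Hww as [W1 W2].
  apply (in_L2_iff W S0 _ weight_root_of) in Hg as [G1 G2].
  assert (Hboth : forall eps, 0 < eps -> exists v',
    finsupp (re v') /\ finsupp (im v') /\
    dist2 (re v') (re (V g)) < eps /\ dist2 (im v') (im (V g)) < eps /\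
    dist2 (jacobi d b (re v')) (re w) < eps /\ dist2 (jacobi d b (im v')) (im w) < eps).
  { intros eps Heps.
    (* [L2norm] is the root of the sum of the two squared distances, so each of them falls below
       [eps]. *)
    destruct (Hcl (sqrt eps) (sqrt_lt_R0 _ Heps)) as (v' & w' & ((n0 & F) & T) & N1 & N2).
    assert (F1 : finsupp (re v')).
    { exists n0. intros n Hn. unfold re. now rewrite (F n Hn). }
    assert (F2 : finsupp (im v')).
    { exists n0. intros n Hn. unfold im. now rewrite (F n Hn). }
    assert (T1 : forall n, re w' n = jacobi d b (re v') n).
    { intros n. unfold re at 1. rewrite (T n). apply pi_lax_parts. }
    assert (T2 : forall n, im w' n = jacobi d b (im v') n).
    { intros n. unfold im at 1. rewrite (T n). apply pi_lax_parts. }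
    assert (J1 := finsupp_l2 _ (finsupp_jacobi d b _ F1)).
    assert (J2 := finsupp_l2 _ (finsupp_jacobi d b _ F2)).
    assert (Lv' : in_L2 unit_weight v') by (apply in_l2_iff; split; now apply finsupp_l2).
    assert (Lw' : in_L2 unit_weight w').
    { apply in_l2_iff. split; [apply l2_ext with (2 := J1)|apply l2_ext with (2 := J2)];
        intros n; symmetry; auto. }
    rewrite L2norm_dist2 in N1, N2 by assumption.
    apply sqrt_lt_0_alt in N1. apply sqrt_lt_0_alt in N2.
    rewrite (dist2_ext _ _ _ (re w) T1 (fun n => eq_refl)),
      (dist2_ext _ _ _ (im w) T2 (fun n => eq_refl)) in N2.
    assert (Hn : forall u v, l2 u -> l2 v -> 0 <= dist2 u v)
      by (intros; now apply dot_nonneg, l2_minus).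
    assert (Q1 := Hn _ _ (finsupp_l2 _ F1) V1). assert (Q2 := Hn _ _ (finsupp_l2 _ F2) V2).
    assert (Q3 := Hn _ _ J1 W1). assert (Q4 := Hn _ _ J2 W2).
    exists v'. repeat split; auto; lra. }
  assert (R1 : app A (re w) x = f x * app A (re (V g)) x).
  { apply (closure_eigen d b); auto. intros eps Heps.
    destruct (Hboth eps Heps) as (v' & ? & ? & ? & ? & ? & ?). now exists (re v'). }
  assert (R2 : app A (im w) x = f x * app A (im (V g)) x).
  { apply (closure_eigen d b); auto. intros eps Heps.
    destruct (Hboth eps Heps) as (v' & ? & ? & ? & ? & ? & ?). now exists (im v'). }
  apply (weighted_ext S0 (U w) (fun x => (RtoC (f x) * g x)%C)); [apply S0_pos| |].
  + rewrite (proj1 (U_parts w x)). rewrite R1.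
    change (re (V g)) with (app (tr A) (wre S0 g)).
    rewrite (app_tr_app (tr A)) by assumption. unfold wre, Re. simpl. ring.
  + rewrite (proj2 (U_parts w x)). rewrite R2.
    change (im (V g)) with (app (tr A) (wim S0 g)).
    rewrite (app_tr_app (tr A)) by assumption. unfold wim, Im. simpl. ring.
- intros (Hg & Hg' & Eg').
  split; [exact Hg|]. exists (V g'). split; [|intros x; symmetry; now apply U_op_U_inv].
  assert (HV := U_inv_maps g Hg). assert (HV' := U_inv_maps g' Hg').
  split; [exact HV|]. split; [exact HV'|]. intros eps Heps.
  apply (in_L2_iff W S0 _ weight_root_of) in Hg as [G1 G2].
  apply (in_L2_iff W S0 _ weight_root_of) in Hg' as [G1' G2'].
  assert (E1 : forall x, wre S0 g' x = f x * wre S0 g x).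
  { intros x. unfold wre, Re. rewrite Eg'. simpl. ring. }
  assert (E2 : forall x, wim S0 g' x = f x * wim S0 g x).
  { intros x. unfold wim, Im. rewrite Eg'. simpl. ring. }
  assert (Hlim := fun x =>
    charlier_matrix_offdiag_lim _ _ h r x charlier_param_pos charlier_sign_sqr).
  (* Real and imaginary parts are approximated separately; their squared errors must add up to less
     than eps^2. *)
  assert (He : 0 < eps * eps / 2) by nra.
  destruct (finsupp_core d b A f (wre S0 g) _ HA HB HE (fun x => proj1 (Hlim x))
    (fun x => proj2 (Hlim x)) G1 (l2_ext _ _ E1 G1') He) as (v1 & F1 & A1 & B1).
  destruct (finsupp_core d b A f (wim S0 g) _ HA HB HE (fun x => proj1 (Hlim x))
    (fun x => proj2 (Hlim x)) G2 (l2_ext _ _ E2 G2') He) as (v2 & F2 & A2 & B2).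
  set (v' := fun n => ((v1 n, v2 n) : C)).
  assert (Lv' : in_L2 unit_weight v').
  { apply in_l2_iff. split; [exact (finsupp_l2 _ F1)|exact (finsupp_l2 _ F2)]. }
  assert (T1 : forall n, re (pi_lax k h c r s v') n = jacobi d b v1 n)
    by (intros n; apply (proj1 (pi_lax_parts v' n))).
  assert (T2 : forall n, im (pi_lax k h c r s v') n = jacobi d b v2 n)
    by (intros n; apply (proj2 (pi_lax_parts v' n))).
  assert (Lw' : in_L2 unit_weight (pi_lax k h c r s v')).
  { apply in_l2_iff. split;
      [apply l2_ext with (2 := finsupp_l2 _ (finsupp_jacobi d b _ F1))
      |apply l2_ext with (2 := finsupp_l2 _ (finsupp_jacobi d b _ F2))];
      intros n; symmetry; auto. }
  assert (Hsq : forall p q, p < eps * eps / 2 -> q < eps * eps / 2 -> sqrt (p + q) < eps).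
  { intros p q Hp Hq. rewrite <- (sqrt_square eps) by lra.
    destruct (Rle_or_lt 0 (p + q)) as [P|P].
    - apply sqrt_lt_1; nra.
    - rewrite sqrt_neg_0 by lra. apply sqrt_lt_R0. nra. }
  exists v', (pi_lax k h c r s v'). split; [|split].
  + split; [|easy]. destruct F1 as [n1 F1]. destruct F2 as [n2 F2].
    exists (n1 + n2)%nat. intros n Hn. unfold v'. rewrite F1, F2 by lia. reflexivity.
  + rewrite L2norm_dist2 by assumption. apply Hsq; [exact A1|exact A2].
  + rewrite L2norm_dist2 by assumption. apply Hsq.
    * eapply Rle_lt_trans; [|exact B1]. apply Req_le, dist2_ext; [exact T1|].
      intros n. now apply app_ext.
    * eapply Rle_lt_trans; [|exact B2]. apply Req_le, dist2_ext; [exact T2|].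
      intros n. now apply app_ext.
Qed.

End Fixed_time.

Theorem theorem5p2 :
  forall (c : R) (r s u : R -> R) (h k : R),
    c <> 0 ->
    C1_halfline r ->
    C1_halfline s ->
    continuous_on_halfline u ->
    (forall t, 0 <= t -> is_derive_halfline s t (2 * r t * u t)) ->
    (forall t, 0 <= t -> is_derive_halfline r t (- 2 * c * u t)) ->
    (forall t, 0 < t -> sign (u t) = sign (r t)) ->
    0 < s 0 ->
    0 < r 0 ->
    (forall t, 0 < t -> 0 < r t /\ 0 < s t) ->
    0 < h ->
    0 <= k ->
    exists C0 : R,
      (forall t, 0 <= t -> C0 = 1 / (2 * c) * r t ^ 2 + s t) /\
      forall t, 0 < t ->
        is_unitary unit_weight (weight h c (r t)) (U_op h c (r t)) /\
        exists U_star : (nat -> C) -> nat -> C,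
          is_adjoint unit_weight (weight h c (r t)) (U_op h c (r t)) U_star /\
          op_eq
            (op_conj (weight h c (r t)) (U_op h c (r t))
               (lax_op k h c (r t) (s t)) U_star)
            (mult_op (weight h c (r t)) (fun x => 2 * c * (INR x + k) - C0 * h)).
Proof.
intros c r s u h k Hc _ _ _ Hs Hr _ _ _ Hpos Hh _.
assert (HC := conserved_quantity c r s u Hc Hs Hr).
exists (1 / (2 * c) * r 1 ^ 2 + s 1). split; [intros t Ht; symmetry; now apply HC|].
intros t Ht.
assert (Hrt : r t <> 0) by (destruct (Hpos t Ht); lra).
split; [now apply U_op_unitary|].
exists (U_inv h c (r t)). split; [now apply U_inv_adjoint|].
apply U_conj_lax; auto. symmetry. apply HC. lra.
Qed.
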